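(* Let $d\ge1$, $\varepsilon>0$, $C,C_0\in\mathfrak S^+(d)$, $z_0=(q_0,p_0)\in\mathbb R^{2d}$, and for $z=(q,p)\in\mathbb R^{2d}$ let $g_z=g_z^{C,\varepsilon}$ and $\psi_0:=g_{z_0}^{C_0,\varepsilon}$ be Gaussian wave packets with the same semiclassical scaling. Put $$A:=i(C_0-\overline C)^{-1},\qquad b_q(x):=x-q-iAC_0(q-q_0),$$ $$c_q(x):=\frac{\det(\operatorname{Im}C\,\operatorname{Im}C_0)^{1/4}}{(\pi\varepsilon)^d\sqrt{2^d\det(A^{-1})}}\exp\left(-\frac1{2\varepsilon}(q-q_0)^T\overline CAC_0(q-q_0)+\frac i\varepsilon p_0^T(x-q_0)\right).$$ Then, for all $q,x\in\mathbb R^d$, $$\mathcal I_q(x):=(2\pi\varepsilon)^{-d}\int_{\mathbb R^d}\langle g_{(q,p)}\mid\psi_0\rangle\,g_{(q,p)}(x)\,dp$$ can be written as $$\mathcal I_q(x)=g_0(x-q)\,c_q(x)\int_{\mathbb R^d}\exp\left(-\frac1{2\varepsilon}p^TAp+\frac i\varepsilon b_q(x)^Tp\right)dp.$$ In particular, the integral on the right-hand side exists, because $\operatorname{Re}(A)$ is positive definite.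
   Context: $\mathfrak S^+(d)$ is the set of complex symmetric $d\times d$ matrices with positive definite imaginary part; $\overline C$ is the entrywise complex conjugate. For $C\in\mathfrak S^+(d)$ and $z=(q,p)\in\mathbb R^{2d}$, $$g_z^{C,\varepsilon}(x)=(\pi\varepsilon)^{-d/4}\det(\operatorname{Im}C)^{1/4}\exp\left[\frac i\varepsilon\left(\frac12(x-q)^TC(x-q)+p^T(x-q)\right)\right],$$ and $g_0:=g^{C,\varepsilon}_{(0,0)}$. The inner product is $\langle f\mid h\rangle=\int_{\mathbb R^d}\overline{f(x)}\,h(x)\,dx$. The square root $\sqrt{\det(A^{-1})}$ is the branch of $B\mapsto\sqrt{\det B}$ on complex symmetric matrices $B$ with positive definite real part that is continuous and positive for real $B$ (here $A^{-1}=-i(C_0-\overline C)$ has positive definite real part $\operatorname{Im}C+\operatorname{Im}C_0$). *)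

(* Defs.v *)
From HB Require Import structures.
From mathcomp Require Import all_boot all_order all_algebra.
From mathcomp Require Import all_classical all_reals all_analysis.
From mathcomp Require Import complex.
Set Implicit Arguments.
Unset Strict Implicit.
Unset Printing Implicit Defensive.
Import Order.TTheory GRing.Theory Num.Theory numFieldNormedType.Exports.
Local Open Scope classical_set_scope.
Local Open Scope ring_scope.

(* The image of m \x mu under the bijection (a, t) |-> a :: t from T * T^n to
   T^(n+1). *)
Section product_cons.
Context {d : measure_display} {T : measurableType d} {R : realType} {n : nat}.
Variables (m : {sigma_finite_measure set T -> \bar R})
  (mu : {sigma_finite_measure set (n.-tuple T) -> \bar R}).

Let consT (u : T * n.-tuple T) : n.+1.-tuple T := [tuple of u.1 :: u.2].

Let unconsT (t : n.+1.-tuple T) : T * n.-tuple T :=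
  (thead t, [tuple of behead t]).

Let consTK : cancel consT unconsT.
Proof. by move=> [a t]; congr pair; apply/val_inj. Qed.

Let measurable_consT : measurable_fun setT consT.
Proof.
exact: (measurable_cons (f := fst) (g := snd) measurable_fst measurable_snd).
Qed.

Let measurable_unconsT : measurable_fun setT unconsT.
Proof.
apply/measurable_fun_pairP; split; first exact: (measurable_tnth ord0).
exact: measurable_behead.
Qed.

Definition product_cons : set (n.+1.-tuple T) -> \bar R :=
  pushforward (m \x mu)%E (fun u : T * n.-tuple T => [tuple of u.1 :: u.2]).

Let product_cons0 : product_cons set0 = 0%E.
Proof. by rewrite /product_cons /pushforward preimage_set0 measure0. Qed.

Let product_cons_ge0 A : (0 <= product_cons A)%E.
Proof. exact: measure_ge0. Qed.

Let product_cons_sigma_additive : semi_sigma_additive product_cons.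
Proof.
move=> F mF tF mUF; rewrite /product_cons /pushforward preimage_bigcup.
apply: measure_semi_sigma_additive.
- by move=> k; rewrite -[X in measurable X]setTI; exact: measurable_consT.
- apply/trivIsetP => /= i j _ _ ij; rewrite -preimage_setI.
  by move/trivIsetP : tF => /(_ _ _ _ _ ij) ->//; rewrite preimage_set0.
- rewrite -preimage_bigcup -[X in measurable X]setTI.
  exact: measurable_consT.
Qed.

HB.instance Definition _ := isMeasure.Build _ _ _ product_cons
  product_cons0 product_cons_ge0 product_cons_sigma_additive.

Let product_cons_sigma_finite : sigma_finite setT product_cons.
Proof.
have /sigma_finiteP[F [TF ndF Foo]] := sigma_finiteT m.
have /sigma_finiteP[G [TG ndG Goo]] := sigma_finiteT mu.
exists (fun k => unconsT @^-1` (F k `*` G k)).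
  apply/esym; rewrite -subTset => t _.
  have : [set: T] (thead t) by [].
  have : [set: n.-tuple T] [tuple of behead t] by [].
  rewrite TF TG => -[i _ Gi] [j _ Fj]; exists (maxn i j) => //; split => /=.
    by apply: subsetPset (thead t) Fj; exact/ndF/leq_maxr.
  by apply: subsetPset [tuple of behead t] Gi; exact/ndG/leq_maxl.
move=> k; have [mFk Fkoo] := Foo k; have [mGk Gkoo] := Goo k; split.
  rewrite -[X in measurable X]setTI; apply: measurable_unconsT => //.
  exact: measurableX.
rewrite /product_cons /pushforward.
rewrite -[X in (m \x mu)%E X]/((unconsT \o consT) @^-1` _).
rewrite (_ : unconsT \o consT = id); last exact/funext.
by rewrite product_measure1E// lte_mul_pinfty// ge0_fin_numE.
Qed.

HB.instance Definition _ := Measure_isSigmaFinite.Build _ _ _ product_cons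
  product_cons_sigma_finite.

End product_cons.

(* The n-fold product m \x ... \x m; T^0 is one point, of mass 1. *)
Fixpoint product_pow d (T : measurableType d) (R : realType)
    (m : {sigma_finite_measure set T -> \bar R}) (n : nat) :
    {sigma_finite_measure set (n.-tuple T) -> \bar R} :=
  if n is n'.+1 then product_cons m (product_pow m n')
  else dirac [tuple].

Definition lebesgue_measure_Rd (R : realType) (d : nat) :
    {sigma_finite_measure set (d.-tuple (measurableTypeR R)) -> \bar R} :=
  product_pow (@lebesgue_measure R) d.

Local Open Scope complex_scope.

(* The topology of R[i] is the one given by its modulus. *)
HB.instance Definition _ (R : rcfType) :=
  GRing.ComAlgebra.copy R[i] (R[i] : numClosedFieldType)^o.
HB.instance Definition _ (R : rcfType) :=
  Vector.copy R[i] (R[i] : numClosedFieldType)^o.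
HB.instance Definition _ (R : rcfType) :=
  NormedModule.copy R[i] (R[i] : numClosedFieldType)^o.

Section complex_integral.
Variables (R : realType) (d : nat).
Implicit Type f : 'cV[R]_d -> R[i].

Definition col_of (t : d.-tuple (measurableTypeR R)) : 'cV[R]_d :=
  \col_i tnth t i.

Definition Cintegrable f : Prop :=
  (lebesgue_measure_Rd R d).-integrable setT
    (fun t => (complex.Re (f (col_of t)))%:E) /\
  (lebesgue_measure_Rd R d).-integrable setT
    (fun t => (complex.Im (f (col_of t)))%:E).

(* A junk value unless Cintegrable f. *)
Definition Cintegral f : R[i] :=
  (\int[lebesgue_measure_Rd R d]_t complex.Re (f (col_of t))) +i*
  (\int[lebesgue_measure_Rd R d]_t complex.Im (f (col_of t))).

End complex_integral.

Definition cexp (R : realType) (z : R[i]) : R[i] :=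
  (expR (complex.Re z))%:C *
  (cos (complex.Im z) +i* sin (complex.Im z)).

Section gaussian_wave_packets.
Variables (R : realType) (d : nat).

Definition toC m n (M : 'M[R]_(m, n)) : 'M[R[i]]_(m, n) :=
  map_mx (real_complex R) M.
Definition Remx m n (M : 'M[R[i]]_(m, n)) : 'M[R]_(m, n) :=
  map_mx (@complex.Re R) M.
Definition Immx m n (M : 'M[R[i]]_(m, n)) : 'M[R]_(m, n) :=
  map_mx (@complex.Im R) M.
Definition conjmx m n (M : 'M[R[i]]_(m, n)) : 'M[R[i]]_(m, n) :=
  map_mx (@conjc R) M.

Definition posdefmx (M : 'M[R]_d) : Prop :=
  M^T = M /\ forall x : 'cV[R]_d, x != 0 -> 0 < (x^T *m M *m x) 0 0.

Definition siegel : set 'M[R[i]]_d :=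
  [set C | C^T = C /\ posdefmx (Immx C)].

Definition symRepos : set 'M[R[i]]_d :=
  [set B | B^T = B /\ posdefmx (Remx B)].

(* The order on R[i] makes 0 < z mean that z is real and positive. *)
Definition sqrt_det_branch (s : 'M[R[i]]_d -> R[i]) : Prop :=
  [/\ {within symRepos, continuous s},
      forall B, symRepos B -> s B ^+ 2 = \det B
    & forall M : 'M[R]_d, posdefmx M -> 0 < s (toC M)].

(* These conditions determine the values on symRepos (a convex set), the only
   ones that matter; the values elsewhere are arbitrary. *)
Definition sqrt_det : 'M[R[i]]_d -> R[i] := xget (fun=> 0) sqrt_det_branch.

Definition dotC (u v : 'cV[R[i]]_d) : R[i] := (u^T *m v) 0 0.

Definition wave_packet (C : 'M[R[i]]_d) (eps : R) (z : 'cV[R]_d * 'cV[R]_d)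
    (x : 'cV[R]_d) : R[i] :=
  let: (q, p) := z in
  let y := toC (x - q) in
  ((pi * eps) `^ (- (d%:R / 4)) * (\det (Immx C)) `^ (1 / 4))%:C *
  cexp ('i%C / eps%:C * (1 / 2 * dotC y (C *m y) + dotC (toC p) y)).

Definition inner_integrand (f h : 'cV[R]_d -> R[i]) (x : 'cV[R]_d) : R[i] :=
  conjc (f x) * h x.

Definition inner (f h : 'cV[R]_d -> R[i]) : R[i] :=
  Cintegral (inner_integrand f h).

Variables (eps : R) (C C0 : 'M[R[i]]_d) (q0 p0 : 'cV[R]_d).

Definition Amx : 'M[R[i]]_d := 'i%C *: invmx (C0 - conjmx C).

Definition b_ (q x : 'cV[R]_d) : 'cV[R[i]]_d :=
  toC (x - q) - 'i%C *: (Amx *m C0 *m toC (q - q0)).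

Definition c_ (q x : 'cV[R]_d) : R[i] :=
  ((\det (Immx C *m Immx C0)) `^ (1 / 4))%:C /
  (((pi * eps) ^+ d * Num.sqrt (2 ^+ d))%:C * sqrt_det (invmx Amx)) *
  cexp (- (1 / (2 * eps%:C)) *
          dotC (toC (q - q0)) (conjmx C *m Amx *m C0 *m toC (q - q0))
        + 'i%C / eps%:C * dotC (toC p0) (toC (x - q0))).

Definition I_integrand (q x p : 'cV[R]_d) : R[i] :=
  inner (wave_packet C eps (q, p)) (wave_packet C0 eps (q0, p0)) *
  wave_packet C eps (q, p) x.

Definition I_ (q x : 'cV[R]_d) : R[i] :=
  ((2 * pi * eps) ^- d)%:C * Cintegral (I_integrand q x).

Definition phase_integrand (q x p : 'cV[R]_d) : R[i] :=
  cexp (- (1 / (2 * eps%:C)) * dotC (toC p) (Amx *m toC p)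
        + 'i%C / eps%:C * dotC (b_ q x) (toC p)).

End gaussian_wave_packets.

(* Main.v *)
(* With B = A^-1 = -i (C_0 - conj C), the inner product < g_(q,p) | psi_0 > is a
   Gaussian integral in y with quadratic form B / eps, and its closed form is
   again a Gaussian in p, with quadratic form A / eps; multiplied by g_(q,p)(x),
   it is the phase integrand evaluated at p - p_0.  Every integral in sight is
   therefore a (shifted) Gaussian, and shifting does not change the closed form
     int exp (- x^T B x / 2 + w^T x) dx
       = (2 pi)^(n/2) / sqrt (det B) exp (w^T B^-1 w / 2).
   This formula is obtained by integrating out one coordinate at a time, which
   replaces B by the Schur complement of its pivot; the product of the principal
   square roots of the pivots is the branch of sqrt (det B).  On the line, the
   formula is carried from b = a > 0, w = 0 to b = a + i t and any w along
   (a + i s t, s w), 0 <= s <= 1, by a linear differential equation. *)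
Require Import Defs.
From mathcomp Require Import all_boot all_order all_algebra.
From mathcomp Require Import all_classical all_reals all_analysis.
From mathcomp Require Import measurable_realfun normal_distribution.
From mathcomp Require Import complex ring lra.
Set Implicit Arguments.
Unset Strict Implicit.
Unset Printing Implicit Defensive.
Import Order.TTheory GRing.Theory Num.Theory numFieldNormedType.Exports.
Local Open Scope classical_set_scope.
Local Open Scope ring_scope.
Local Open Scope complex_scope.

(** * The Gaussian integral on the line *)

(** The linear term [w] is complex, so completing the square would translate the domain of
    integration off the real space. It is therefore carried as a parameter both by the differential
    equation and by the elimination of coordinates, and every shift that occurs is real. Integrating
    coordinate by coordinate presupposes integrability on the product. The modulus of the Gaussian
    with data [(B, w)] is the real Gaussian with data [(Re B, Re w)], whose slices obey the same
    formula: Tonelli and the induction hypothesis give its integrability, comparison gives that of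
    the complex Gaussian, and only then does Fubini give the value. [sqrt_det] is chosen by its
    three defining properties alone. Identifying it with the product of the square roots of the
    pivots takes both halves of a characterization: this product has the three properties, and two
    functions having them agree on [symRepos]. *)

Section gaussian_domination.
Context {R : realType}.
Local Notation mu := (@lebesgue_measure R).
Implicit Types a x : R.

(** Majorants keep half of the exponent [- a x^2 / 2] of the integrands; the other half absorbs
    powers of [x] and factors [exp (N |x|)]. *)
Definition egauss a x : R := expR (- (a / 4) * x ^+ 2).

Lemma gaussE a x : 0 < a ->
  expR (- (a / 2) * x ^+ 2) =
  Num.sqrt (2 * pi / a) * normal_pdf 0 (Num.sqrt a^-1) x.
Proof.
move=> a0; have sa : Num.sqrt a^-1 ^+ 2 = a^-1 by rewrite sqr_sqrtr// invr_ge0 ltW.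
have s0 : Num.sqrt a^-1 != 0 by rewrite gt_eqF// sqrtr_gt0 invr_gt0.
rewrite normal_pdfE// /normal_peak /normal_fun sa.
rewrite (_ : a^-1 * pi *+ 2 = 2 * pi / a); last by field; rewrite gt_eqF.
rewrite [RHS]mulrA mulfV ?mul1r; last first.
  by rewrite gt_eqF// sqrtr_gt0 divr_gt0// mulr_gt0// pi_gt0.
by congr expR; rewrite subr0; field; rewrite gt_eqF.
Qed.

Lemma Rintegral_gauss a : 0 < a ->
  \int[mu]_x expR (- (a / 2) * x ^+ 2) = Num.sqrt (2 * pi / a).
Proof.
move=> a0; under eq_Rintegral do rewrite gaussE//.
rewrite RintegralZl//; last exact: integrable_normal_pdf.
by rewrite /Rintegral integral_normal_pdf mulr1.
Qed.

Lemma integrable_egauss a : 0 < a -> mu.-integrable setT (EFin \o egauss a).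
Proof.
move=> a0; have a20 : 0 < a / 2 by rewrite divr_gt0.
have aE : a / 4 = a / 2 / 2 by field.
apply: (@eq_integrable _ _ _ mu setT measurableT (fun x =>
  (Num.sqrt (2 * pi / (a / 2)))%:E * (normal_pdf 0 (Num.sqrt (a / 2)^-1) x)%:E)%E).
  by move=> x _; rewrite [RHS]/= /egauss aE (gaussE _ a20) EFinM.
by apply: integrableZl => //; exact: integrable_normal_pdf.
Qed.

Lemma le_egauss a N x : 0 < a ->
  expR (- (a / 2) * x ^+ 2 + N * `|x|) <= expR (N ^+ 2 / a) * egauss a x.
Proof.
move=> a0; rewrite -expRD ler_expR -subr_ge0 -(real_normK (num_real x)).
rewrite (_ : _ - _ = a * (`|x| / 2 - N / a) ^+ 2); last by field; rewrite gt_eqF.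
by rewrite mulr_ge0 ?sqr_ge0// ltW.
Qed.

Lemma integrable_dominated a (f : R -> R) K : 0 < a ->
  measurable_fun setT f -> (forall x, `|f x| <= K * egauss a x) ->
  mu.-integrable setT (EFin \o f).
Proof.
move=> a0 mf fK; have := integrable_egauss a0.
move/(integrableZl measurableT K); apply: le_integrable => //.
  exact/measurable_EFinP.
move=> x _; rewrite /= lee_fin (le_trans (fK x))// ?ler_norm//.
Qed.

Lemma cvg_egauss_nat a K : 0 < a -> K * egauss a n%:R @[n --> \oo] --> (0 : R).
Proof.
move=> a0; rewrite -[X in _ --> X](mulr0 K); apply: cvgMr.
apply/cvgrPdist_le => e e0; near=> n; rewrite sub0r normrN ger0_norm ?expR_ge0//.
have n0 : 0 < n%:R :> R by near: n; exact: nbhs_infty_gtr.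
rewrite /egauss mulNr expRN -[e]invrK lef_pV2 ?posrE ?expR_gt0 ?invr_gt0//.
apply: (@le_trans _ _ (1 + a / 4 * n%:R ^+ 2)); last exact: expR_ge1Dx.
have n1 : 1 <= n%:R :> R by near: n; exact: nbhs_infty_ger.
have : 4 * e^-1 / a <= n%:R by near: n; exact: nbhs_infty_ger.
rewrite ler_pdivrMr// => H.
have : n%:R <= n%:R ^+ 2 :> R by rewrite expr2 ler_peMr// ltW.
nra.
Unshelve. all: end_near. Qed.

(** The integral of [f] over [[-n, n]] is [F n - F (- n)], which tends to 0 by the Gaussian bound on
    [F]; dominated convergence with majorant [|f|] passes to the line. This is what removes the
    boundary terms in integrations by parts. *)
Lemma Rintegral_derive_eq0 a K (F f : R -> R) : 0 < a ->
  (forall x, is_derive x 1 F (f x)) -> continuous f ->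
  mu.-integrable setT (EFin \o f) ->
  (forall x, `|F x| <= K * egauss a x) ->
  \int[mu]_x f x = 0.
Proof.
move=> a0 dF cf intf FK.
pose f_ n := (EFin \o (f \_ `[- n%:R, n%:R])) : R -> \bar R.
have mf : measurable_fun setT f by apply/measurable_EFinP; exact: measurable_int intf.
have ff x : f_ n x @[n --> \oo] --> (f x)%:E.
  apply: cvg_near_cst; near=> n; rewrite /f_ /= patchE ifT// inE /= in_itv/=.
  by rewrite -ler_norml; near: n; exact: nbhs_infty_ger.
have mf_ n : measurable_fun setT (f_ n).
  apply/measurable_EFinP.
  by apply/(measurable_restrictT _ _).1 => //; apply: measurable_funTS.
have f_f : {ae mu, forall x, setT x -> f_ ^~ x @ \oo --> (EFin \o f) x}.
  by apply: aeW => x _; exact: ff.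
have dom : {ae mu, forall x n, setT x -> (`|f_ n x| <= `|f x|%:E)%E}.
  apply: aeW => x n _; rewrite /f_ /= lee_fin patchE; case: ifP => // _.
  by rewrite normr0.
have [_ _] := @dominated_convergence _ _ _ mu _ measurableT f_ _ _ mf_
  (measurable_int _ intf) f_f (integrable_norm intf) dom.
rewrite (_ : [sequence _]_n = fun n => (F n%:R - F (- n%:R))%:E); last first.
  apply/funext => n /=.
  transitivity (\int[mu]_(x in `[(- n%:R)%R, n%:R%R]) (f x)%:E)%E.
    by rewrite [RHS]integral_mkcond restrict_EFin.
  have [->|n0] := eqVneq n 0%N.
    by rewrite oppr0 set_itv1 integral_set1 subrr.
  rewrite (@continuous_FTC2 _ f F)//.
  - by rewrite -subr_gt0 opprK addr_gt0// ltr0n lt0n.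
  - by apply: continuous_subspaceT => ?; exact: cf.
  - have cF x : {for x, continuous F}.
      by apply: differentiable_continuous; apply/derivable1_diffP; case: (dF x).
    split; first by move=> x _; case: (dF x).
      by apply: cvg_at_right_filter; exact: cF.
    by apply: cvg_at_left_filter; exact: cF.
  - by move=> x _; rewrite derive1E; case: (dF x).
move/(cvg_lim (@ereal_hausdorff R)) => h.
rewrite /Rintegral -[X in fine X]h (cvg_lim (@ereal_hausdorff R) (l := 0%E))//.
apply: cvg_EFin; first exact: nearW.
rewrite -[X in _ --> X]subr0; apply: cvgB.
  apply: (@squeeze_cvgr _ _ _ _ (fun n => - (K * egauss a n%:R))
    (fun n => K * egauss a n%:R)).
  - by near=> n => /=; rewrite -ler_norml.
  - by rewrite -[X in _ --> X]oppr0; apply: cvgN; exact: cvg_egauss_nat.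
  - exact: cvg_egauss_nat.
apply: (@squeeze_cvgr _ _ _ _ (fun n => - (K * egauss a n%:R))
  (fun n => K * egauss a n%:R)).
- by near=> n => /=; rewrite -ler_norml (le_trans (FK _))// /egauss sqrrN.
- by rewrite -[X in _ --> X]oppr0; apply: cvgN; exact: cvg_egauss_nat.
- exact: cvg_egauss_nat.
Unshelve. all: end_near. Qed.

End gaussian_domination.

Section has_integral.
Context d (T : measurableType d) (R : realType) (mu : {measure set T -> \bar R}).

(** The value of an integral is meaningful only together with integrability; bundling the two lets
    linearity rules be chained without side conditions. *)
Definition has_Rintegral (f : T -> R) (v : R) : Prop :=
  mu.-integrable setT (EFin \o f) /\ \int[mu]_x f x = v.

Lemma has_RintegralD f g u v : has_Rintegral f u -> has_Rintegral g v ->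
  has_Rintegral (fun x => f x + g x) (u + v).
Proof.
move=> [fi <-] [gi <-]; split; last by rewrite RintegralD.
by apply: eq_integrable (integrableD _ fi gi) => // x _; rewrite /= EFinD.
Qed.

Lemma has_RintegralZ f u c : has_Rintegral f u ->
  has_Rintegral (fun x => c * f x) (c * u).
Proof.
move=> [fi <-]; split; last by rewrite RintegralZl.
by apply: eq_integrable (integrableZl _ c fi) => // x _; rewrite /= EFinM.
Qed.

Lemma eq_has_Rintegral f g u : f =1 g -> has_Rintegral f u -> has_Rintegral g u.
Proof. by move=> /funext ->. Qed.

End has_integral.

(** This is the division of [u + i v] by [p + i q], written in real and imaginary parts. *)
Lemma rotation_solve (F : realFieldType) (p q x y u v : F) : 0 < p ->
  p * x - q * y = u -> p * y + q * x = v ->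
  x = (p * u + q * v) / (p ^+ 2 + q ^+ 2) /\
  y = (p * v - q * u) / (p ^+ 2 + q ^+ 2).
Proof.
move=> p0 <- <-; have D0 : p ^+ 2 + q ^+ 2 != 0.
  by rewrite gt_eqF// ltr_wpDr ?exprn_gt0// sqr_ge0.
by split; field; rewrite -?expr2.
Qed.

(** * The complex Gaussian on the line, through a differential equation in [s] *)

Section oscillating_gaussian.
Context {R : realType}.
Local Notation mu := (@lebesgue_measure R).
Variables a t w1 w2 : R.
Hypothesis a0 : 0 < a.
Implicit Types al be r s x : R.

(* The real part of (al - i be) exp (- (a + i s t) x^2 / 2 + s (w1 + i w2) x). *)
Definition osc (al be s x : R) : R :=
  expR (- (a / 2) * x ^+ 2 + s * w1 * x) *
  (al * cos (s * w2 * x - s * t / 2 * x ^+ 2) +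
   be * sin (s * w2 * x - s * t / 2 * x ^+ 2)).

Definition moment k al be s : R := \int[mu]_x (x ^+ k * osc al be s x).

(** Replacing [(al, be)] by [(be, - al)] multiplies the complex integrand by [i]. The two summands
    thus come from the real and imaginary parts of the logarithmic derivative
    [- (a + i s t) x + s (w1 + i w2)]. *)
Lemma is_derive_osc al be s x :
  is_derive x 1 (osc al be s)
    ((- a * x + s * w1) * osc al be s x
     + (s * w2 - s * t * x) * osc be (- al) s x).
Proof. by rewrite /osc; apply: is_derive_eq; rewrite /GRing.scale /=; field. Qed.

Lemma is_derive_osc_param al be s x :
  is_derive s 1 (osc al be ^~ x)
    (w1 * x * osc al be s x
     + (w2 * x - t / 2 * x ^+ 2) * osc be (- al) s x).
Proof. by rewrite /osc; apply: is_derive_eq; rewrite /GRing.scale /=; field. Qed.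

Lemma osc_le al be s x :
  `|osc al be s x| <=
  (`|al| + `|be|) * expR (- (a / 2) * x ^+ 2 + `|s * w1| * `|x|).
Proof.
rewrite /osc normrM mulrC ler_pM// ?normr_ge0//; last first.
  by rewrite ger0_norm ?expR_ge0// ler_expR lerD2l -normrM ler_norm.
rewrite (le_trans (ler_normD _ _))// !normrM lerD// ler_piMr//.
  by rewrite ler_norml cos_geN1 cos_le1.
by rewrite ler_norml sin_geN1 sin_le1.
Qed.

(** A power of [x] thus only raises the coefficient [N] in [le_egauss] by [k]. *)
Lemma exprn_le_expR (x : R) k : `|x| ^+ k <= expR (k%:R * `|x|).
Proof.
rewrite expRM_natl; apply: lerXn2r; rewrite ?nnegrE ?expR_ge0//.
by rewrite (le_trans _ (expR_ge1Dx _))// lerDr.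
Qed.

Lemma expr_osc_le k al be s x :
  `|x ^+ k * osc al be s x| <=
  (`|al| + `|be|) * expR (- (a / 2) * x ^+ 2 + (`|s * w1| + k%:R) * `|x|).
Proof.
rewrite normrM (mulrDl _ _ `|x|) addrA expRD mulrA [leLHS]mulrC normrX.
by rewrite ler_pM ?exprn_ge0 ?osc_le ?exprn_le_expR.
Qed.

Lemma expr_osc_le_egauss k al be s : exists K, forall x,
  `|x ^+ k * osc al be s x| <= K * egauss a x.
Proof.
exists ((`|al| + `|be|) * expR ((`|s * w1| + k%:R) ^+ 2 / a)) => x.
rewrite (le_trans (expr_osc_le _ _ _ _ _))// -mulrA.
by rewrite ler_wpM2l ?addr_ge0// le_egauss.
Qed.

Lemma is_derive_expr_osc k al be s x :
  is_derive x 1 (fun x => x ^+ k * osc al be s x)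
    (k%:R * (x ^+ k.-1 * osc al be s x) + x ^+ k *
     ((- a * x + s * w1) * osc al be s x
      + (s * w2 - s * t * x) * osc be (- al) s x)).
Proof.
have d1 : is_derive x 1 (fun y : R => y ^+ k) (k%:R * x ^+ k.-1).
  rewrite (_ : (fun y => _) = id ^+ k); last by apply/funext => y; rewrite exprfctE.
  by apply: is_derive_eq; rewrite /GRing.scale /= mulr1.
apply: is_derive_eq (is_deriveM d1 (is_derive_osc al be s x)) _.
by rewrite /GRing.scale /=; ring.
Qed.

Lemma continuous_expr_osc k al be s : continuous (fun x => x ^+ k * osc al be s x).
Proof.
move=> x; apply: differentiable_continuous; apply/derivable1_diffP.
by case: (is_derive_expr_osc k al be s x).
Qed.

Lemma integrable_expr_osc k al be s :
  mu.-integrable setT (EFin \o (fun x => x ^+ k * osc al be s x)).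
Proof.
have [K KP] := expr_osc_le_egauss k al be s.
apply: (integrable_dominated a0 _ KP).
by apply: continuous_measurable_fun; exact: continuous_expr_osc.
Qed.

Lemma has_Rintegral_osc k al be s :
  has_Rintegral mu (fun x => x ^+ k * osc al be s x) (moment k al be s).
Proof. by split => //; exact: integrable_expr_osc. Qed.

Lemma momentE k al be s :
  moment k al be s = al * moment k 1 0 s + be * moment k 0 1 s.
Proof.
have [_ <-] := has_RintegralD (has_RintegralZ al (has_Rintegral_osc k 1 0 s))
  (has_RintegralZ be (has_Rintegral_osc k 0 1 s)).
by apply: eq_Rintegral => x _; rewrite /osc; ring.
Qed.

(** The left-hand side is the integral of the derivative of [x^k osc], hence 0. For [k = 0] the
    truncated index [k.-1] is harmless, its coefficient being 0. *)
Lemma moment_by_parts k al be s :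
  k%:R * moment k.-1 al be s - a * moment k.+1 al be s
  + s * w1 * moment k al be s + s * w2 * moment k be (- al) s
  - s * t * moment k.+1 be (- al) s = 0.
Proof.
pose f x := k%:R * (x ^+ k.-1 * osc al be s x) + (- a) * (x ^+ k.+1 * osc al be s x)
  + s * w1 * (x ^+ k * osc al be s x) + s * w2 * (x ^+ k * osc be (- al) s x)
  + (- (s * t)) * (x ^+ k.+1 * osc be (- al) s x).
have [fi fE] : has_Rintegral mu f (k%:R * moment k.-1 al be s
  + (- a) * moment k.+1 al be s
  + s * w1 * moment k al be s + s * w2 * moment k be (- al) s
  + (- (s * t)) * moment k.+1 be (- al) s).
  by rewrite /f; do ![apply: has_RintegralD|apply: has_RintegralZ|
    exact: has_Rintegral_osc].
transitivity (\int[mu]_x f x); first by rewrite fE; ring.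
have [K KP] := expr_osc_le_egauss k al be s.
apply: (Rintegral_derive_eq0 a0 _ _ fi KP).
  move=> x; have ? := is_derive_expr_osc k al be s x; apply: is_derive_eq.
  by rewrite /f !exprS; ring.
have cZ c j al' be' : continuous (fun x => c * (x ^+ j * osc al' be' s x)).
  by move=> x; apply: cvgMr; exact: continuous_expr_osc.
by move=> x; rewrite /f; do ![apply: cvgD; last exact: cZ]; exact: cZ.
Qed.

Lemma is_derive_moment0 al be s :
  is_derive s 1 (moment 0 al be)
    (w1 * moment 1 al be s + w2 * moment 1 be (- al) s
     - t / 2 * moment 2 be (- al) s).
Proof.
(* A majorant valid for all parameters [r] in []s - 1, s + 1[]: there [|r w1|] is at most
   [(|s| + 1) |w1|], and the 2 pays for the highest power [x^2] brought down by the derivative in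
   [s]. *)
pose M := (`|s| + 1) * `|w1| + 2.
pose K := (`|al| + `|be|) * (`|w1| + `|w2| + `|t / 2|) * expR (M ^+ 2 / a).
have is_derive_expr0_osc r x : is_derive r 1 (fun s => x ^+ 0 * osc al be s x)
    (w1 * x * osc al be r x + (w2 * x - t / 2 * x ^+ 2) * osc be (- al) r x).
  under eq_fun do rewrite mul1r; exact: is_derive_osc_param.
have dE r x : partial1of2 (fun s x => x ^+ 0 * osc al be s x) r x =
    w1 * (x ^+ 1 * osc al be r x) + w2 * (x ^+ 1 * osc be (- al) r x)
    + (- (t / 2)) * (x ^+ 2 * osc be (- al) r x).
  by rewrite partial1of2E (@derive_val _ _ _ _ _ _ _ (is_derive_expr0_osc r x)); ring.
have ub r x : `]s - 1, s + 1[%classic r -> setT x ->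
    `|partial1of2 (fun s x => x ^+ 0 * osc al be s x) r x| <= K * egauss a x.
  rewrite /= in_itv/= => /andP[sr rs] _; rewrite dE.
  have rM : `|r * w1| + 2 <= M.
    rewrite lerD2r normrM ler_wpM2r//; have [r0|r0] := ger0P r.
      by rewrite (le_trans (ltW rs))// lerD2r ler_norm.
    rewrite (@le_trans _ _ (1 - s))//; first by lra.
    by rewrite addrC lerD2r -normrN ler_norm.
  have b k al' be' : (k <= 2)%N ->
      `|x ^+ k * osc al' be' r x| <=
      (`|al'| + `|be'|) * (expR (M ^+ 2 / a) * egauss a x).
    move=> k2; apply: (le_trans (expr_osc_le _ _ _ _ _)).
    rewrite ler_wpM2l ?addr_ge0//; apply: le_trans (le_egauss _ _ a0).
    rewrite ler_expR lerD2l ler_wpM2r//; apply: le_trans rM.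
    by rewrite lerD2l ler_nat.
  rewrite (_ : K * _ = `|w1| * ((`|al| + `|be|) * (expR (M ^+ 2 / a) * egauss a x))
    + `|w2| * ((`|be| + `|- al|) * (expR (M ^+ 2 / a) * egauss a x))
    + `|- (t / 2)| * ((`|be| + `|- al|) * (expR (M ^+ 2 / a) * egauss a x))).
    rewrite (le_trans (ler_normD _ _))// lerD//.
      rewrite (le_trans (ler_normD _ _))// lerD//.
        by rewrite normrM ler_wpM2l// b.
      by rewrite normrM ler_wpM2l// b.
    by rewrite normrM ler_wpM2l// b.
  by rewrite /K !normrN; ring.
have intK : mu.-integrable setT (EFin \o (fun x => K * egauss a x)).
  have := integrableZl measurableT K (integrable_egauss a0).
  by apply: eq_integrable.
have K0 x : 0 <= K * egauss a x.
  by rewrite !mulr_ge0 ?addr_ge0 ?expR_ge0.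
have Is : `]s - 1, s + 1[%classic s by rewrite /= in_itv/= ltrBlDr ltrDl ltr01.
have di r x : `]s - 1, s + 1[%classic r -> setT x ->
    derivable (fun s => x ^+ 0 * osc al be s x) r 1.
  by move=> _ _; have [] := is_derive_expr0_osc r x.
have ii r : `]s - 1, s + 1[%classic r ->
    mu.-integrable setT (EFin \o (fun x => x ^+ 0 * osc al be r x)).
  by move=> _; exact: integrable_expr_osc.
apply: DeriveDef.
  exact: (derivable_under_integral measurableT Is ii di K0 intK ub).
rewrite -derive1E.
rewrite (differentiation_under_integral measurableT Is ii di K0 intK ub).
under eq_Rintegral do rewrite dE.
suff [] : has_Rintegral mu (fun x => w1 * (x ^+ 1 * osc al be s x)
    + w2 * (x ^+ 1 * osc be (- al) s x)
    + (- (t / 2)) * (x ^+ 2 * osc be (- al) s x))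
  (w1 * moment 1 al be s + w2 * moment 1 be (- al) s
     + - (t / 2) * moment 2 be (- al) s).
  by move=> _ ->; rewrite mulNr.
by do ![apply: has_RintegralD|apply: has_RintegralZ|exact: has_Rintegral_osc].
Qed.

Local Notation X := (moment 0 1 0).
Local Notation Y := (moment 0 0 1).
Local Notation D s := (a ^+ 2 + (s * t) ^+ 2).

(* With b = a + i s t and w = w1 + i w2, logre s + i logim s is a logarithm of
   sqrt b * exp (- (s w)^2 / (2 b)). *)
Definition logre s : R := ln (D s) / 4
  - s ^+ 2 * ((w1 ^+ 2 - w2 ^+ 2) * a + 2 * w1 * w2 * (s * t)) / (2 * D s).

Definition logim s : R := atan (s * t / a) / 2
  - s ^+ 2 * (2 * w1 * w2 * a - (w1 ^+ 2 - w2 ^+ 2) * (s * t)) / (2 * D s).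

Let D_gt0 s : 0 < D s.
Proof. by rewrite ltr_wpDr ?exprn_gt0// sqr_ge0. Qed.

Let is_derive_lnD s :
  is_derive s 1 (fun s => ln (D s)) ((D s)^-1 * (2 * s * t ^+ 2)).
Proof.
apply: (@is_derive1_comp _ (@ln R) (fun s => D s)).
  exact/is_derive1_ln/D_gt0.
by apply: is_derive_eq; rewrite /GRing.scale /=; ring.
Qed.

Let is_derive_invD s : is_derive s 1 (fun s => (2 * D s)^-1)
  (- (2 * D s) ^- 2 * (2 * (2 * s * t ^+ 2))).
Proof.
apply: is_deriveV; first by rewrite mulf_neq0// gt_eqF.
by apply: is_derive_eq; rewrite /GRing.scale /=; ring.
Qed.

Let is_derive_atan s :
  is_derive s 1 (fun s => atan (s * t / a)) ((1 + (s * t / a) ^+ 2)^-1 * (t / a)).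
Proof.
apply: (@is_derive1_comp _ (@atan R) (fun s => s * t / a)).
by apply: is_derive_eq; rewrite /GRing.scale /=; ring.
Qed.

Let is_derive_logre s : is_derive s 1 logre
  (s * t ^+ 2 / (2 * D s)
   - (2 * s * ((w1 ^+ 2 - w2 ^+ 2) * a + 2 * w1 * w2 * (s * t))
      + s ^+ 2 * (2 * w1 * w2 * t)) / (2 * D s)
   + s ^+ 2 * ((w1 ^+ 2 - w2 ^+ 2) * a + 2 * w1 * w2 * (s * t)) * (s * t ^+ 2)
     / D s ^+ 2).
Proof.
have D00 := lt0r_neq0 (D_gt0 s).
have lnD := is_derive_lnD s; have invD := is_derive_invD s.
have atD := is_derive_atan s.
rewrite /logre; apply: is_derive_eq.
by rewrite /GRing.scale /=; field; exact: D00.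
Qed.

Let is_derive_logim s : is_derive s 1 logim
  (t * a / (2 * D s)
   - (2 * s * (2 * w1 * w2 * a - (w1 ^+ 2 - w2 ^+ 2) * (s * t))
      - s ^+ 2 * ((w1 ^+ 2 - w2 ^+ 2) * t)) / (2 * D s)
   + s ^+ 2 * (2 * w1 * w2 * a - (w1 ^+ 2 - w2 ^+ 2) * (s * t)) * (s * t ^+ 2)
     / D s ^+ 2).
Proof.
have D00 := lt0r_neq0 (D_gt0 s).
have lnD := is_derive_lnD s; have invD := is_derive_invD s.
have atD := is_derive_atan s.
rewrite /logim; apply: is_derive_eq.
by rewrite /GRing.scale /=; field; rewrite D00 gt_eqF.
Qed.

(** With [m_k] the complex [k]-th moment, integration by parts at [k = 0] reads
    [(a + i s t) m_1 = s w m_0]. *)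
Let moment1 s :
  let u := s * w1 * X s - s * w2 * Y s in let v := s * w1 * Y s + s * w2 * X s in
  moment 1 1 0 s = (a * u + s * t * v) / D s /\
  moment 1 0 1 s = (a * v - s * t * u) / D s.
Proof.
move=> u v; apply: rotation_solve => //.
  have := moment_by_parts 0 1 0 s.
  rewrite (momentE 0 0 (- 1)) (momentE 1 0 (- 1)) /u => h.
  apply/esym/eqP; rewrite -subr_eq0; apply/eqP; rewrite -[RHS]h /=; ring.
have := moment_by_parts 0 0 1 s; rewrite oppr0 /v /= => h.
  apply/esym/eqP; rewrite -subr_eq0; apply/eqP; rewrite -[RHS]h /=; ring.
Qed.

(** Integration by parts at [k = 1] reads [(a + i s t) m_2 = m_0 + s w m_1]. *)
Let moment2 s :
  let u := X s + s * w1 * moment 1 1 0 s - s * w2 * moment 1 0 1 s in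
  let v := Y s + s * w1 * moment 1 0 1 s + s * w2 * moment 1 1 0 s in
  moment 2 1 0 s = (a * u + s * t * v) / D s /\
  moment 2 0 1 s = (a * v - s * t * u) / D s.
Proof.
move=> u v; apply: rotation_solve => //.
  have := moment_by_parts 1 1 0 s.
  rewrite /= (momentE 1 0 (- 1)) (momentE 2 0 (- 1)) /u => h.
  apply/esym/eqP; rewrite -subr_eq0; apply/eqP; rewrite -[RHS]h /=; ring.
have := moment_by_parts 1 0 1 s; rewrite oppr0 /v /= => h.
  apply/esym/eqP; rewrite -subr_eq0; apply/eqP; rewrite -[RHS]h /=; ring.
Qed.

(* Psi1 + i Psi2 = (X + i Y) exp (logre + i logim) does not depend on s. *)
Let Psi1 s := expR (logre s) * (X s * cos (logim s) - Y s * sin (logim s)).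
Let Psi2 s := expR (logre s) * (X s * sin (logim s) + Y s * cos (logim s)).

(** With [b = a + i s t], eliminating the first and second moments from [m_0' = w m_1 - i t m_2 / 2]
    leaves [m_0' = (s w^2 / b - i t / (2 b) - i t s^2 w^2 / (2 b^2)) m_0]. The factor is minus the
    derivative of [logre + i logim]. *)
Let dPsi s : is_derive s 1 Psi1 0 /\ is_derive s 1 Psi2 0.
Proof.
have D00 := lt0r_neq0 (D_gt0 s).
have dL1 := is_derive_logre s; have dL2 := is_derive_logim s.
have dX := is_derive_moment0 1 0 s; have dY := is_derive_moment0 0 1 s.
rewrite (momentE 1 0 (- 1)) (momentE 2 0 (- 1)) in dX.
rewrite oppr0 in dY.
have [m11 m12] := moment1 s; have [m21 m22] := moment2 s.
rewrite m22 m11 m12 in dX; rewrite m21 m11 m12 in dY.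
split; rewrite /Psi1 /Psi2; apply: is_derive_eq; rewrite /GRing.scale /=.
  by field; exact: D00.
by field; exact: D00.
Qed.

Lemma sqrtr_expR (x : R) : 0 < x -> Num.sqrt x = expR (ln x / 2).
Proof.
move=> x0; rewrite -[in LHS](lnK x0) -{1}(divfK (_ : 2 != 0) (ln x))//.
by rewrite expRM_natr sqrtr_sqr ger0_norm ?expR_ge0.
Qed.

Let Psi_0 : Psi1 0 = Num.sqrt (2 * pi) /\ Psi2 0 = 0.
Proof.
have X0 : X 0 = Num.sqrt (2 * pi / a).
  rewrite -Rintegral_gauss//; apply: eq_Rintegral => x _.
  by rewrite /osc !mul0r !subr0 cos0 !addr0 !mul1r mulr1.
have Y0 : Y 0 = 0.
  rewrite -[RHS](mul0r (fine (mu setT))) -(Rintegral_cst mu measurableT).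
  apply: eq_Rintegral => x _.
  by rewrite /osc !mul0r !subr0 sin0 add0r !mulr0.
have L2 : logim 0 = 0 by rewrite /logim !mul0r atan0 !expr0n /= !mul0r subrr.
have L1 : logre 0 = ln a / 2.
  by rewrite /logre mul0r !expr0n /= !mul0r subr0 addr0 lnXn// -mulr_natr; field.
rewrite /Psi1 /Psi2. rewrite X0 Y0 L1 L2 cos0 sin0 !mulr0 mulr1 subr0 mul0r addr0 mulr0.
split=> //; rewrite -sqrtr_expR// -sqrtrM ?ltW//.
by congr Num.sqrt; field; rewrite gt_eqF.
Qed.

Lemma moment0_1 :
  X 1 = Num.sqrt (2 * pi) * expR (- logre 1) * cos (logim 1) /\
  Y 1 = - (Num.sqrt (2 * pi) * expR (- logre 1) * sin (logim 1)).
Proof.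
have [P1 P2] := Psi_0.
have := is_derive_0_is_cst 1 0 (fun s => (dPsi s).1); rewrite P1.
have := is_derive_0_is_cst 1 0 (fun s => (dPsi s).2); rewrite P2.
rewrite /Psi1 /Psi2 /= expRN => h2 h1; have e0 := lt0r_neq0 (expR_gt0 (logre 1)).
have cs := cos2Dsin2 (logim 1).
have -> : Num.sqrt (2 * pi) * (expR (logre 1))^-1 =
    X 1 * cos (logim 1) - Y 1 * sin (logim 1).
  by rewrite -h1; field.
have h : X 1 * sin (logim 1) + Y 1 * cos (logim 1) = 0.
  by move/eqP : h2; rewrite mulf_eq0 (negbTE e0) => /eqP.
split.
  transitivity (X 1 * (cos (logim 1) ^+ 2 + sin (logim 1) ^+ 2)
     - sin (logim 1) * (X 1 * sin (logim 1) + Y 1 * cos (logim 1))); last by ring.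
  by rewrite cs h; ring.
transitivity (Y 1 * (cos (logim 1) ^+ 2 + sin (logim 1) ^+ 2)
     - cos (logim 1) * (X 1 * sin (logim 1) + Y 1 * cos (logim 1))); last by ring.
by rewrite cs h; ring.
Qed.

End oscillating_gaussian.

(** * Complex exponential, principal square root and the Gaussian integral on the line *)

Section complex_exponential.
Context {R : realType}.
Implicit Types z w : R[i].

Lemma Re_cexp z : complex.Re (cexp z) = expR (complex.Re z) * cos (complex.Im z).
Proof. by case: z => x y; rewrite /cexp /=; simpc. Qed.

Lemma Im_cexp z : complex.Im (cexp z) = expR (complex.Re z) * sin (complex.Im z).
Proof. by case: z => x y; rewrite /cexp /=; simpc. Qed.

Lemma eq_complexP z w :
  complex.Re z = complex.Re w -> complex.Im z = complex.Im w -> z = w.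
Proof. by case: z w => [a b] [c d] /= -> ->. Qed.

Lemma cexpD z w : cexp (z + w) = cexp z * cexp w.
Proof.
case: z w => [a b] [c d]; apply: eq_complexP.
  by rewrite Re_cexp /= expRD cosD /cexp /=; simpc => /=; ring.
by rewrite Im_cexp /= expRD sinD /cexp /=; simpc => /=; ring.
Qed.

Lemma cexp_real (x : R) : cexp x%:C = (expR x)%:C.
Proof. by rewrite /cexp /= cos0 sin0; simpc. Qed.

Lemma cexp0 : cexp (0 : R[i]) = 1.
Proof. by rewrite (cexp_real 0) expR0. Qed.

Lemma cexpN z : cexp (- z) = (cexp z)^-1.
Proof.
have h : cexp z * cexp (- z) = 1 by rewrite -cexpD subrr cexp0.
have z0 : cexp z != 0.
  by apply: contra_eq_neq h => ->; rewrite mul0r eq_sym oner_neq0.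
by rewrite -[LHS]mul1r -(mulVf z0) -mulrA h mulr1.
Qed.

Lemma cexp_neq0 z : cexp z != 0.
Proof.
have h : cexp z * cexp (- z) = 1 by rewrite -cexpD subrr cexp0.
by apply: contra_eq_neq h => ->; rewrite mul0r eq_sym oner_neq0.
Qed.

(* The principal branch, for b in the right half-plane. *)
Definition csqrt (b : R[i]) : R[i] :=
  cexp ((ln (complex.Re b ^+ 2 + complex.Im b ^+ 2) / 4) +i*
        (atan (complex.Im b / complex.Re b) / 2)).

Lemma csqrt_neq0 b : csqrt b != 0. Proof. exact: cexp_neq0. Qed.

Lemma csqr_csqrt b : 0 < complex.Re b -> csqrt b ^+ 2 = b.
Proof.
case: b => [x y] /= x0; rewrite /csqrt expr2 -cexpD /=.
have n0 : 0 < x ^+ 2 + y ^+ 2 by rewrite ltr_wpDr ?exprn_gt0// sqr_ge0.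
have -> : ((ln (x ^+ 2 + y ^+ 2) / 4) +i* (atan (y / x) / 2)
    + (ln (x ^+ 2 + y ^+ 2) / 4) +i* (atan (y / x) / 2)) =
  (ln (x ^+ 2 + y ^+ 2) / 2) +i* atan (y / x) by apply: eq_complexP => /=; field.
(* Polar form: [cos (atan u) = 1 / sqrt (1 + u^2)] at [u = y / x] cancels the modulus up to [x],
   which is positive; the imaginary part then follows from the tangent. *)
have cx : expR (ln (x ^+ 2 + y ^+ 2) / 2) * cos (atan (y / x)) = x.
  rewrite -sqrtr_expR// cos_atan -sqrtrV; last by rewrite addr_ge0// sqr_ge0.
  rewrite -sqrtrM ?ltW//.
  rewrite (_ : (x ^+ 2 + y ^+ 2) / (1 + (y / x) ^+ 2) = x ^+ 2).
    by rewrite sqrtr_sqr gtr0_norm.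
  by field; rewrite !gt_eqF.
apply: eq_complexP; rewrite ?Re_cexp ?Im_cexp //=.
have : cos (atan (y / x)) != 0.
  by apply/eqP => c0; move: x0; rewrite -cx c0 mulr0 ltxx.
move=> c0; have := atanK (y / x); rewrite /tan.
move=> /(congr1 (fun u => u * cos (atan (y / x)))).
rewrite divfK// => ->; rewrite mulrCA cx; field; exact: lt0r_neq0.
Qed.

Lemma csqrt_real (x : R) : 0 < x -> csqrt x%:C = (Num.sqrt x)%:C.
Proof.
move=> x0; rewrite /csqrt /= mul0r atan0 mul0r expr0n addr0 (cexp_real) sqrtr_expR//.
by rewrite lnXn// -mulr_natr; congr (expR _)%:C; field.
Qed.

Lemma csqrtZ (c : R) b : 0 < c -> 0 < complex.Re b ->
  csqrt (c%:C * b) = (Num.sqrt c)%:C * csqrt b.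
Proof.
case: b => [x y] /= c0 x0; rewrite /csqrt sqrtr_expR// -cexp_real -cexpD.
congr cexp; simpc => /=; congr (_ +i* _).
  have n0 : 0 < x ^+ 2 + y ^+ 2 by rewrite ltr_wpDr ?exprn_gt0// sqr_ge0.
  by rewrite !exprMn -mulrDr lnM ?posrE ?exprn_gt0// lnXn// -mulr_natr; field.
by rewrite -mulf_div divff ?mul1r// gt_eqF.
Qed.

End complex_exponential.

Section complex_valued_integrals.
Context d (T : measurableType d) (R : realType) (mu : {measure set T -> \bar R}).
Implicit Types (f g : T -> R[i]) (u v c : R[i]).

Definition has_Cintegral f u :=
  has_Rintegral mu (fun x => complex.Re (f x)) (complex.Re u) /\
  has_Rintegral mu (fun x => complex.Im (f x)) (complex.Im u).

Lemma has_CintegralZ f u c : has_Cintegral f u ->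
  has_Cintegral (fun x => c * f x) (c * u).
Proof.
case: c => a b [hr hi]; split.
  have := has_RintegralD (has_RintegralZ a hr) (has_RintegralZ (- b) hi).
  have -> : complex.Re ((a +i* b) * u) = a * complex.Re u + - b * complex.Im u.
    by case: u {hr hi} => [p q] /=; simpc.
  by apply: eq_has_Rintegral => x; case: (f x) => p q /=; simpc.
have := has_RintegralD (has_RintegralZ a hi) (has_RintegralZ b hr).
have -> : complex.Im ((a +i* b) * u) = a * complex.Im u + b * complex.Re u.
  by case: u {hr hi} => [p q] /=; simpc.
by apply: eq_has_Rintegral => x; case: (f x) => p q /=; simpc.
Qed.

Lemma eq_has_Cintegral f g u : f =1 g -> has_Cintegral f u -> has_Cintegral g u.
Proof. by move=> /funext ->. Qed.

End complex_valued_integrals.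

Section gaussian_line.
Context {R : realType}.
Local Notation mu := (@lebesgue_measure R).
Variables b w : R[i].
Hypothesis b0 : 0 < complex.Re b.

(** At [s = 1], the pairs [(1, 0)] and [(0, 1)] of coefficients in [osc] give the real and imaginary
    parts of the integrand, whose integrals are in [moment0_1]. *)
Lemma has_Cintegral_gaussian_line :
  has_Cintegral mu (fun x : R => cexp (- (1 / 2) * (x%:C * b * x%:C) + w * x%:C))
    ((Num.sqrt (2 * pi))%:C / csqrt b * cexp (1 / 2 * (w ^+ 2 / b))).
Proof.
case: b w b0 => [a t] [w1 w2] /= a0.
pose z := logre a t w1 w2 1 +i* logim a t w1 w2 1.
have -> : (Num.sqrt (2 * pi))%:C / csqrt (a +i* t)
    * cexp (1 / 2 * ((w1 +i* w2) ^+ 2 / (a +i* t))) =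
  (Num.sqrt (2 * pi))%:C * cexp (- z).
  rewrite /csqrt -cexpN -mulrA -cexpD /=; congr (_ * cexp _).
  have D0 : a ^+ 2 + t ^+ 2 != 0.
    by rewrite gt_eqF// ltr_wpDr ?exprn_gt0// sqr_ge0.
  have -> : (w1 +i* w2) ^+ 2 / (a +i* t) =
    (((w1 ^+ 2 - w2 ^+ 2) * a + 2 * w1 * w2 * t) / (a ^+ 2 + t ^+ 2)) +i*
    ((2 * w1 * w2 * a - (w1 ^+ 2 - w2 ^+ 2) * t) / (a ^+ 2 + t ^+ 2)).
    have at0 : a +i* t != 0 by rewrite eq_complex /= negb_and gt_eqF.
    apply: (mulIf at0); rewrite divfK//; apply: eq_complexP.
      by rewrite expr2; simpc => /=; field.
    by rewrite expr2; simpc => /=; field.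
  have -> : (1 / 2 : R[i]) = (1 / 2 : R)%:C by rewrite rmorphM/= fmorphV /= !rmorph_nat.
  apply: eq_complexP; rewrite /z /logre /logim !expr1n !mul1r; simpc => /=.
    by field.
  by field.
have [X1 Y1] := moment0_1 t w1 w2 a0.
have oscE (x : R) : cexp (- (1 / 2) * (x%:C * (a +i* t) * x%:C) + (w1 +i* w2) * x%:C) =
    (x ^+ 0 * osc a t w1 w2 1 0 1 x) +i* (x ^+ 0 * osc a t w1 w2 0 1 1 x).
  have -> : (1 / 2 : R[i]) = (1 / 2 : R)%:C by rewrite rmorphM/= fmorphV /= !rmorph_nat.
  have -> : - (1 / 2)%:C * (x%:C * (a +i* t) * x%:C) + (w1 +i* w2) * x%:C =
    (- (a / 2) * x ^+ 2 + 1 * w1 * x) +i* (1 * w2 * x - 1 * t / 2 * x ^+ 2).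
    by apply: eq_complexP; simpc => /=; field.
  by apply: eq_complexP; rewrite ?Re_cexp ?Im_cexp /osc /=; ring.
split.
  have := has_Rintegral_osc t w1 w2 a0 0 1 0 1; rewrite X1.
  rewrite (_ : complex.Re _ = Num.sqrt (2 * pi) * expR (- logre a t w1 w2 1) *
    cos (logim a t w1 w2 1)); last first.
    by rewrite /cexp /z /= cosN; simpc => /=; ring.
  by apply: eq_has_Rintegral => x; rewrite oscE.
have := has_Rintegral_osc t w1 w2 a0 0 0 1 1; rewrite Y1.
rewrite (_ : complex.Im _ = - (Num.sqrt (2 * pi) * expR (- logre a t w1 w2 1) *
    sin (logim a t w1 w2 1))); last first.
  by rewrite /cexp /z /= sinN; simpc => /=; ring.
by apply: eq_has_Rintegral => x; rewrite oscE.
Qed.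

End gaussian_line.

(** * Gaussian integrals in several variables *)

Lemma has_Rintegral_EFin d (T : measurableType d) (R : realType)
    (mu : {measure set T -> \bar R}) (f : T -> R) v :
  has_Rintegral mu f v -> (\int[mu]_x (f x)%:E = v%:E)%E.
Proof. by move=> [fi <-]; rewrite fineK//; exact: integrable_fin_num. Qed.

(** * Iterated integrals and measurability *)

Section product_integrals.
Context d1 d2 (T1 : measurableType d1) (T2 : measurableType d2) (R : realType).
Variables (m1 : {sigma_finite_measure set T1 -> \bar R}).
Variables (m2 : {sigma_finite_measure set T2 -> \bar R}).

(** Tonelli: for a nonnegative function, the integrals of the slices decide integrability on the
    product. It will be applied to the real majorant. *)
Lemma integrable_prod_ge0 (h : T1 * T2 -> R) (k : T2 -> R) :
  measurable_fun setT h -> (forall z, 0 <= h z) ->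
  (forall y, has_Rintegral m1 (fun x => h (x, y)) (k y)) ->
  m2.-integrable setT (EFin \o k) ->
  (m1 \x m2)%E.-integrable setT (EFin \o h).
Proof.
move=> mh h0 hk ki; apply/integrable21ltyP; first exact/measurable_EFinP.
have -> : (fun y => \int[m1]_x `|(EFin \o h) (x, y)|)%E = (EFin \o k).
  apply/funext => y /=; rewrite -(has_Rintegral_EFin (hk y)).
  by apply: eq_integral => x _; rewrite /= ger0_norm.
by have /integrable_fin_num := ki; rewrite ltey_eq => ->.
Qed.

Lemma has_Rintegral_prod (f : T1 * T2 -> R) (F : T2 -> R) v :
  (m1 \x m2)%E.-integrable setT (EFin \o f) ->
  (forall y, has_Rintegral m1 (fun x => f (x, y)) (F y)) ->
  has_Rintegral m2 F v -> has_Rintegral (m1 \x m2)%E f v.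
Proof.
move=> fi fF [Fi <-]; split => //; rewrite /Rintegral; congr fine.
rewrite -integral21_prod_meas1//; apply: eq_integral => y _.
exact: has_Rintegral_EFin.
Qed.

End product_integrals.

Section product_cons_integral.
Context d (T : measurableType d) (R : realType) (n : nat).
Variables (m : {sigma_finite_measure set T -> \bar R}).
Variables (mu : {sigma_finite_measure set (n.-tuple T) -> \bar R}).

Lemma has_Rintegral_product_cons (f : n.+1.-tuple T -> R) v :
  measurable_fun setT f ->
  has_Rintegral (m \x mu)%E (fun z => f [tuple of z.1 :: z.2]) v ->
  has_Rintegral (product_cons m mu) f v.
Proof.
move=> mf [fi <-].
have mc : measurable_fun setT (fun u : T * n.-tuple T => [tuple of u.1 :: u.2]).
  exact: (measurable_cons (f := fst) (g := snd) measurable_fst measurable_snd).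
split.
  by apply: (integrable_pushforward mc) => //; exact/measurable_EFinP.
congr fine; apply: (@integral_pushforward _ _ _ _ _ _ mc (m \x mu)%E setT) => //.
exact/measurable_EFinP.
Qed.

End product_cons_integral.

Section complex_measurability.
Context d (T : measurableType d) (R : realType).
Implicit Types f g : T -> R[i].

Definition Cmeasurable f := measurable_fun setT (fun x => complex.Re (f x)) /\
  measurable_fun setT (fun x => complex.Im (f x)).

Lemma Cmeasurable_cst (c : R[i]) : Cmeasurable (fun=> c).
Proof. by split; exact: measurable_cst. Qed.

Lemma Cmeasurable_real (f : T -> R) : measurable_fun setT f ->
  Cmeasurable (fun x => (f x)%:C).
Proof. by move=> mf; split => //; exact: measurable_cst. Qed.

Lemma CmeasurableD f g : Cmeasurable f -> Cmeasurable g ->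
  Cmeasurable (fun x => f x + g x).
Proof.
move=> [f1 f2] [g1 g2]; split.
  rewrite (_ : (fun x => _) = (fun x => complex.Re (f x) + complex.Re (g x))).
    exact: measurable_funD.
  by apply/funext => x; case: (f x) (g x) => [? ?] [? ?].
rewrite (_ : (fun x => _) = (fun x => complex.Im (f x) + complex.Im (g x))).
  exact: measurable_funD.
by apply/funext => x; case: (f x) (g x) => [? ?] [? ?].
Qed.

Lemma CmeasurableM f g : Cmeasurable f -> Cmeasurable g ->
  Cmeasurable (fun x => f x * g x).
Proof.
move=> [f1 f2] [g1 g2]; split.
  rewrite (_ : (fun x => _) = (fun x => complex.Re (f x) * complex.Re (g x)
                                       - complex.Im (f x) * complex.Im (g x))).
    by apply: measurable_funB; exact: measurable_funM.
  by apply/funext => x; case: (f x) (g x) => [? ?] [? ?].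
rewrite (_ : (fun x => _) = (fun x => complex.Re (f x) * complex.Im (g x)
                                     + complex.Im (f x) * complex.Re (g x))).
  by apply: measurable_funD; exact: measurable_funM.
by apply/funext => x; case: (f x) (g x) => [? ?] [? ?].
Qed.

Lemma Cmeasurable_sum (I : finType) (F : I -> T -> R[i]) :
  (forall i, Cmeasurable (F i)) -> Cmeasurable (fun x => \sum_i F i x).
Proof.
move=> mF; elim: (index_enum I) => [|i r ih].
  under eq_fun do rewrite big_nil; exact: Cmeasurable_cst.
under eq_fun do rewrite big_cons; exact: CmeasurableD.
Qed.

Lemma Cmeasurable_cexp f : Cmeasurable f -> Cmeasurable (fun x => cexp (f x)).
Proof.
move=> [f1 f2]; split.
  under eq_fun do rewrite Re_cexp.
  apply: measurable_funM; first exact: measurableT_comp.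
  apply: measurableT_comp => //.
  by apply: continuous_measurable_fun; exact: continuous_cos.
under eq_fun do rewrite Im_cexp.
apply: measurable_funM; first exact: measurableT_comp.
apply: measurableT_comp => //.
by apply: continuous_measurable_fun; exact: continuous_sin.
Qed.

End complex_measurability.

Section gaussian.
Context {R : realType}.

Definition gaussian n (B : 'M[R[i]]_n) (w : 'cV[R[i]]_n) (x : 'cV[R]_n) : R[i] :=
  cexp (- (1 / 2) * dotC (toC x) (B *m toC x) + dotC w (toC x)).

Lemma Cmeasurable_gaussian n (B : 'M[R[i]]_n) w :
  Cmeasurable (fun t => gaussian B w (col_of t)).
Proof.
have mx (i : 'I_n) : Cmeasurable (fun t => toC (@col_of R n t) i 0).
  rewrite (_ : (fun t => _) = fun t => (tnth t i)%:C); last first.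
    by apply/funext => t; rewrite !mxE.
  by apply: Cmeasurable_real; exact: measurable_tnth.
apply: Cmeasurable_cexp; apply: CmeasurableD.
  apply: CmeasurableM; first exact: Cmeasurable_cst.
  rewrite /dotC; under eq_fun do rewrite mxE.
  apply: Cmeasurable_sum => i; apply: CmeasurableM.
    by under eq_fun do rewrite mxE.
  under eq_fun do rewrite mxE.
  apply: Cmeasurable_sum => j; apply: CmeasurableM => //.
rewrite /dotC; under eq_fun do rewrite mxE.
apply: Cmeasurable_sum => i; apply: CmeasurableM => //.
Qed.

End gaussian.

(** * Bilinear forms and Schur complements *)

Section bilinear_form.
Context {R : realType}.
Implicit Types n : nat.

Lemma dotCC n (u v : 'cV[R[i]]_n) : dotC u v = dotC v u.
Proof. by rewrite /dotC -[in LHS](trmxK v) -trmx_mul mxE. Qed.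

Lemma dotCDr n (u v w : 'cV[R[i]]_n) : dotC u (v + w) = dotC u v + dotC u w.
Proof. by rewrite /dotC mulmxDr mxE. Qed.

Lemma dotCZr n a (u v : 'cV[R[i]]_n) : dotC u (a *: v) = a * dotC u v.
Proof. by rewrite /dotC -scalemxAr mxE. Qed.

Lemma dotCDl n (u v w : 'cV[R[i]]_n) : dotC (v + w) u = dotC v u + dotC w u.
Proof. by rewrite dotCC dotCDr !(dotCC u). Qed.

Lemma dotCZl n a (u v : 'cV[R[i]]_n) : dotC (a *: v) u = a * dotC v u.
Proof. by rewrite dotCC dotCZr (dotCC u). Qed.

Lemma dotCNr n (u v : 'cV[R[i]]_n) : dotC u (- v) = - dotC u v.
Proof. by rewrite -scaleN1r dotCZr mulN1r. Qed.

Lemma dotCNl n (u v : 'cV[R[i]]_n) : dotC (- v) u = - dotC v u.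
Proof. by rewrite dotCC dotCNr (dotCC u). Qed.

Lemma dotC_mulmx n (M : 'M[R[i]]_n) (u v : 'cV[R[i]]_n) :
  dotC u (M *m v) = dotC (M^T *m u) v.
Proof. by rewrite /dotC trmx_mul trmxK mulmxA. Qed.

Lemma dotC_col_mx n (u1 v1 : 'cV[R[i]]_1) (u2 v2 : 'cV[R[i]]_n) :
  dotC (col_mx u1 u2) (col_mx v1 v2) = dotC u1 v1 + dotC u2 v2.
Proof. by rewrite /dotC tr_col_mx mul_row_col mxE. Qed.

Lemma dotC_scalar (a b : R[i]) : dotC a%:M b%:M = a * b.
Proof. by rewrite /dotC tr_scalar_mx -scalar_mxM mxE eqxx mulr1n. Qed.

End bilinear_form.

Section schur_complement.
Context {R : realType} {n : nat}.
Implicit Types (B : 'M[R[i]]_(1 + n)) (w v : 'cV[R[i]]_(1 + n)).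
Implicit Types (y : 'cV[R[i]]_n) (a : R[i]).

Definition schur B : 'M[R[i]]_n :=
  drsubmx B - (B 0 0)^-1 *: (dlsubmx B *m (dlsubmx B)^T).

Lemma symmetric_blockE B : B^T = B ->
  B = block_mx (B 0 0)%:M (dlsubmx B)^T (dlsubmx B) (drsubmx B).
Proof.
move=> sB; rewrite -[LHS]submxK; congr block_mx.
  by rewrite [ulsubmx B]mx11_scalar !mxE; congr ((B _ _)%:M); apply: val_inj.
by rewrite -{1}sB trmx_dlsub.
Qed.

(** One step of block Gaussian elimination: [B] is a unipotent lower triangular block matrix times
    an upper triangular one with diagonal blocks [B 0 0] and [schur B]. *)
Lemma det_schur B : B^T = B -> B 0 0 != 0 -> \det B = B 0 0 * \det (schur B).
Proof.
move=> sB b0; have BE := symmetric_blockE sB.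
transitivity (\det (block_mx 1%:M 0 ((B 0 0)^-1 *: dlsubmx B) 1%:M *m
    block_mx (B 0 0)%:M (dlsubmx B)^T 0 (schur B))).
  rewrite mulmx_block !mul1mx !mul0mx !addr0 [in LHS]BE; congr (\det (block_mx _ _ _ _)).
    by rewrite -scalemxAl mul_mx_scalar scalerA mulVf// scale1r.
  by rewrite -scalemxAl /schur addrC subrK.
rewrite det_mulmx det_lblock det_ublock !det_scalar !expr1n expr1.
by rewrite mul1r mul1r.
Qed.

Lemma schur_sym B : B^T = B -> (schur B)^T = schur B.
Proof.
move=> sB; rewrite /schur linearB /= linearZ /= trmx_mul trmxK.
by rewrite trmx_drsub sB.
Qed.

Lemma col_mx_scalarE v : v = col_mx (v 0 0)%:M (dsubmx v).
Proof.
rewrite -[LHS]vsubmxK; congr col_mx.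
by rewrite [usubmx v]mx11_scalar !mxE; congr ((v _ _)%:M); apply: val_inj.
Qed.

Lemma dotC_col w a y : dotC w (col_mx a%:M y) = w 0 0 * a + dotC (dsubmx w) y.
Proof. by rewrite {1}(col_mx_scalarE w) dotC_col_mx dotC_scalar. Qed.

Lemma mulmx_sym_col B a y : B^T = B ->
  B *m col_mx a%:M y =
  col_mx (B 0 0 * a + dotC (dlsubmx B) y)%:M (a *: dlsubmx B + drsubmx B *m y).
Proof.
move=> sB; rewrite {1}(symmetric_blockE sB) mul_block_col -scalar_mxM mul_mx_scalar.
by rewrite [X in _%:M + X]mx11_scalar raddfD.
Qed.

Lemma quadratic_sym_col B a y : B^T = B ->
  dotC (col_mx a%:M y) (B *m col_mx a%:M y) =
  B 0 0 * a ^+ 2 + 2 * a * dotC (dlsubmx B) y + dotC y (drsubmx B *m y).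
Proof.
move=> sB; rewrite mulmx_sym_col// dotC_col_mx dotC_scalar dotCDr dotCZr.
by rewrite (dotCC y (dlsubmx B)); ring.
Qed.

Lemma mulmx_schur B y : schur B *m y =
  drsubmx B *m y - (dotC (dlsubmx B) y / B 0 0) *: dlsubmx B.
Proof.
rewrite mulmxBl -scalemxAl -mulmxA [_^T *m y]mx11_scalar mul_mx_scalar scalerA.
by rewrite [_^-1 * _]mulrC.
Qed.

Lemma quadratic_schur B y : dotC y (schur B *m y) =
  dotC y (drsubmx B *m y) - dotC (dlsubmx B) y ^+ 2 / B 0 0.
Proof.
rewrite mulmx_schur dotCDr dotCNr dotCZr (dotCC y (dlsubmx B)).
by rewrite expr2 mulrAC.
Qed.

(* Integrating out the first coordinate of a Gaussian with data (B, w) leaves a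
   Gaussian with data (schur B, schur_rhs B w). *)
Definition schur_rhs B w : 'cV[R[i]]_n := dsubmx w - (w 0 0 / B 0 0) *: dlsubmx B.

(** Eliminating the first unknown of [B v = w] leaves a system solved by the tail of [v]. The
    exponent [w^T v] splits accordingly into the contribution of the pivot and the exponent of the
    smaller Gaussian. *)
Lemma schur_solution B w v : B^T = B -> B 0 0 != 0 -> B *m v = w ->
  schur B *m dsubmx v = schur_rhs B w /\
  dotC w v = w 0 0 ^+ 2 / B 0 0 + dotC (schur_rhs B w) (dsubmx v).
Proof.
move=> sB b0 Bv; have := Bv.
rewrite {1}(col_mx_scalarE v) mulmx_sym_col// {1}(col_mx_scalarE w) => /eq_col_mx[].
move=> /(congr1 (fun M : 'M[R[i]]_1 => M 0 0)); rewrite !mxE !mulr1n => h1 h2.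
pose y := dsubmx v; rewrite -/y in h1 h2 *.
have v0 : v 0 0 = (w 0 0 - dotC (dlsubmx B) y) / B 0 0 by rewrite -h1 addrK mulrC mulKf.
split.
  rewrite mulmx_schur /schur_rhs -h2 v0 mulrBl scalerBl.
  by rewrite [RHS]addrAC [_ - _ - _]addrAC subrr add0r addrC.
by rewrite {1}(col_mx_scalarE v) dotC_col -/y /schur_rhs dotCDl dotCNl dotCZl v0; field.
Qed.

End schur_complement.

(** * Matrices with positive definite real part and their pivots *)

Section positivity.
Context {R : realType} {n : nat}.
Implicit Types (B : 'M[R[i]]_n) (P : 'M[R]_n) (x : 'cV[R[i]]_n) (u v : 'cV[R]_n).

Lemma posdefmx_ge0 P u : posdefmx P -> 0 <= (u^T *m P *m u) 0 0.
Proof.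
move=> [_ pP]; have [->|u0] := eqVneq u 0; first by rewrite mulmx0 mxE.
exact/ltW/pP.
Qed.

Lemma quadratic_sumE (K : comNzRingType) (M : 'M[K]_n) (y z : 'cV[K]_n) :
  (y^T *m M *m z) 0 0 = \sum_i \sum_j y i 0 * M i j * z j 0.
Proof.
rewrite -mulmxA mxE; apply: eq_bigr => i _; rewrite !mxE mulr_sumr.
by apply: eq_bigr => j _; rewrite mulrA.
Qed.

Lemma Re_sum (I : finType) (f : I -> R[i]) :
  complex.Re (\sum_i f i) = \sum_i complex.Re (f i).
Proof. by elim/big_rec2 : _ => // i a b _ <-; case: (f i) b => [? ?] [? ?]. Qed.

(* Defs.conjmx is qualified because mxpoly also has a conjmx. *)
Lemma Re_conj_quadratic B x : B^T = B ->
  complex.Re (dotC (Defs.conjmx x) (B *m x)) =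
  ((Remx x)^T *m Remx B *m Remx x) 0 0 + ((Immx x)^T *m Remx B *m Immx x) 0 0.
Proof.
move=> sB; rewrite /dotC mulmxA !quadratic_sumE Re_sum.
transitivity (\sum_i \sum_j (Remx x i 0 * Remx B i j * Remx x j 0
    + Immx x i 0 * Remx B i j * Immx x j 0)
  + (\sum_i \sum_j Immx x i 0 * Immx B i j * Remx x j 0
     - \sum_i \sum_j Remx x i 0 * Immx B i j * Immx x j 0)).
  rewrite -sumrB -big_split; apply: eq_bigr => i _.
  rewrite Re_sum -sumrB -big_split; apply: eq_bigr => j _ /=.
  by rewrite !mxE; case: (x i 0) (x j 0) (B i j) => [? ?] [? ?] [? ?]; simpc => /=; ring.
(* The cross terms involving [Im B] cancel: swapping the two summations and using the symmetry of
   [B] makes the two sums equal. *)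
rewrite [X in _ + (_ - X)]exchange_big /=.
rewrite [X in _ + (_ - X)](_ : _ = \sum_i \sum_j Immx x i 0 * Immx B i j * Remx x j 0).
  rewrite subrr addr0 -big_split; apply: eq_bigr => i _; exact: big_split.
apply: eq_bigr => i _; apply: eq_bigr => j _.
by rewrite !mxE -{1}sB mxE; ring.
Qed.

(** Positivity is needed on complex vectors because Schur complements and inverses of [B] turn real
    test vectors into complex ones. *)
Lemma Re_conj_quadratic_gt0 B x : symRepos B -> x != 0 ->
  0 < complex.Re (dotC (Defs.conjmx x) (B *m x)).
Proof.
move=> [sB pB] x0; rewrite Re_conj_quadratic//.
have [u0|u0] := eqVneq (Remx x) 0; last first.
  by rewrite ltr_wpDr ?(posdefmx_ge0 _ pB)// pB.2.
rewrite u0 mulmx0 mxE add0r pB.2//; apply: contraNneq x0 => v0.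
apply/eqP/matrixP => i j; apply: eq_complexP.
  by have /matrixP/(_ i j) := u0; rewrite !mxE.
by have /matrixP/(_ i j) := v0; rewrite !mxE.
Qed.

Lemma toC_eq0 u : (toC u == 0) = (u == 0).
Proof. by rewrite /toC map_mx_eq0. Qed.

Lemma Re_quadratic B u :
  complex.Re (dotC (toC u) (B *m toC u)) = (u^T *m Remx B *m u) 0 0.
Proof.
rewrite /dotC mulmxA !quadratic_sumE Re_sum; apply: eq_bigr => i _.
rewrite Re_sum; apply: eq_bigr => j _; rewrite !mxE.
by case: (B i j) => [? ?]; simpc.
Qed.

Lemma Re_dotC (w : 'cV[R[i]]_n) u : complex.Re (dotC w (toC u)) = ((Remx w)^T *m u) 0 0.
Proof.
rewrite /dotC !mxE Re_sum; apply: eq_bigr => i _; rewrite !mxE.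
by case: (w i 0) => [? ?]; simpc.
Qed.

Lemma Remx_toC m k (M : 'M[R]_(m, k)) : Remx (toC M) = M.
Proof. by apply/matrixP => i j; rewrite !mxE. Qed.

Lemma symRepos_toC P : symRepos (toC P) <-> posdefmx P.
Proof.
rewrite /symRepos /= Remx_toC; split=> [[]//|pP]; split=> //.
by rewrite /toC map_trmx pP.1.
Qed.

End positivity.

Section schur_positivity.
Context {R : realType} {n : nat}.
Implicit Types (B : 'M[R[i]]_(1 + n)).

Lemma pivot_gt0 B : symRepos B -> 0 < complex.Re (B 0 0).
Proof.
move=> [sB pB].
have := Re_quadratic B (col_mx 1%:M 0).
have -> : toC (col_mx 1%:M (0 : 'cV[R]_n)) = col_mx 1%:M 0.
  by rewrite /toC map_col_mx map_mx1 map_mx0.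
rewrite quadratic_sym_col// mulmx0 expr1n mulr1.
have d0 (u : 'cV[R[i]]_n) : dotC u 0 = 0 by rewrite /dotC mulmx0 mxE.
rewrite !d0 mulr0 !addr0 => ->; apply: pB.2.
by rewrite col_mx_eq0 negb_and -scalemx1 scale1r matrix_nonzero1.
Qed.

Lemma pivot_neq0 B : symRepos B -> B 0 0 != 0.
Proof. by move/pivot_gt0; apply: contraTneq => ->; rewrite ltxx. Qed.

Lemma symRepos_schur B : symRepos B -> symRepos (schur B).
Proof.
move=> sB; have b0 := pivot_neq0 sB; have [tB pB] := sB.
split; first exact: schur_sym.
split; first by rewrite /Remx map_trmx schur_sym.
move=> y y0; rewrite -Re_quadratic.
(* with this a, B maps (a, y) to (0, schur B y) *)
pose a := - (dotC (dlsubmx B) (toC y) / B 0 0).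
have x0 : col_mx a%:M (toC y) != 0 by rewrite col_mx_eq0 negb_and toC_eq0 y0 orbT.
have := Re_conj_quadratic_gt0 sB x0.
rewrite mulmx_sym_col// /Defs.conjmx map_col_mx map_scalar_mx dotC_col_mx dotC_scalar.
have -> : B 0 0 * a + dotC (dlsubmx B) (toC y) = 0.
  by rewrite /a mulrN mulrCA mulfV// mulr1 addNr.
rewrite mulr0 add0r (_ : map_mx _ (toC y) = toC y); last first.
  by apply/matrixP => i j; rewrite !mxE /= oppr0.
by rewrite mulmx_schur addrC /a scaleNr.
Qed.

End schur_positivity.

(* The product of the principal square roots of the pivots of B.  On symRepos all
   pivots have positive real part, so that no branch cut is met. *)
Fixpoint sdet {R : realType} n : 'M[R[i]]_n -> R[i] :=
  match n with
  | 0 => fun=> 1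
  | n'.+1 => fun B : 'M[R[i]]_(1 + n') => csqrt (B 0 0) * sdet (schur B)
  end.

Section sdet.
Context {R : realType}.

Lemma sdet_neq0 n (B : 'M[R[i]]_n) : sdet B != 0.
Proof.
elim: n B => [|n ih] B /=; first exact: oner_neq0.
by rewrite mulf_neq0// csqrt_neq0.
Qed.

Lemma sqr_sdet n (B : 'M[R[i]]_n) : symRepos B -> sdet B ^+ 2 = \det B.
Proof.
elim: n B => [|n ih] B sB; first by rewrite /= expr1n det_mx00.
rewrite [in LHS]/= exprMn ih; last exact: symRepos_schur.
rewrite csqr_csqrt; last exact: pivot_gt0.
by rewrite -det_schur//; [case: sB|exact: pivot_neq0].
Qed.

(** The determinant is the square of [sdet B], a product of exponentials. *)
Lemma symRepos_unitmx n (B : 'M[R[i]]_n) : symRepos B -> B \in unitmx.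
Proof.
by move=> sB; rewrite unitmxE -sqr_sdet// unitfE expf_neq0// sdet_neq0.
Qed.

(** For real [u] and [x = B^-1 u], the number [x^* B x = x^* u] is the conjugate of [u^T B^-1 u], so
    both have the same positive real part. *)
Lemma symRepos_invmx n (B : 'M[R[i]]_n) : symRepos B -> symRepos (invmx B).
Proof.
move=> sB; have uB := symRepos_unitmx sB; have [tB _] := sB.
split; first by rewrite trmx_inv tB.
split; first by rewrite /Remx map_trmx trmx_inv tB.
move=> u u0; rewrite -Re_quadratic.
have x0 : invmx B *m toC u != 0.
  apply: contraNneq u0 => x0; rewrite -toC_eq0 -(mulKVmx uB (toC u)).
  by rewrite x0 mulmx0.
have := Re_conj_quadratic_gt0 sB x0; rewrite mulKVmx//.
congr (_ < _); rewrite /dotC !mxE !Re_sum; apply: eq_bigr => i _.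
by rewrite !mxE; case: (\sum_j _) => [? ?]; simpc; rewrite mulrC.
Qed.

Lemma sdetZ n (B : 'M[R[i]]_n) (c : R) : 0 < c -> symRepos B ->
  sdet (c%:C *: B) = (Num.sqrt c ^+ n)%:C * sdet B.
Proof.
move=> c0; elim: n B => [|n ih] B sB; first by rewrite /= mulr1.
have cC : c%:C != 0 :> R[i] by rewrite fmorph_eq0 gt_eqF.
rewrite /= mxE csqrtZ//; last exact: pivot_gt0.
have -> : schur (c%:C *: B : 'M[R[i]]_(1 + n)) = c%:C *: schur (B : 'M[R[i]]_(1 + n)).
  apply/matrixP => i j; rewrite !mxE !big_ord1 !mxE; field.
  by rewrite cC (pivot_neq0 sB).
by rewrite ih; [rewrite exprS rmorphM; ring|exact: symRepos_schur].
Qed.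

(** The Schur complement of a real matrix is real, so every pivot is a positive real number with a
    positive principal root. *)
Lemma sdet_real_gt0 n (P : 'M[R]_n) : posdefmx P -> 0 < sdet (toC P).
Proof.
elim: n P => [|n ih] P pP; first exact: ltr01.
have sP : symRepos (toC P) by exact/symRepos_toC.
have P0 : 0 < (P : 'M[R]_(1 + n)) 0 0 by have := pivot_gt0 sP; rewrite mxE.
rewrite /= mxE csqrt_real// mulr_gt0//.
  by rewrite ltcR sqrtr_gt0.
have := symRepos_schur sP.
have -> : schur (toC P : 'M[R[i]]_(1 + n)) = toC (drsubmx (P : 'M[R]_(1 + n)) -
    (P 0 0)^-1 *: (dlsubmx (P : 'M[R]_(1 + n)) *m (dlsubmx (P : 'M[R]_(1 + n)))^T)).
  apply/matrixP => i j; rewrite !mxE !big_ord1 !mxE.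
  by rewrite rmorphB rmorphM fmorphV rmorphM.
by move/symRepos_toC/ih.
Qed.

End sdet.

Lemma integrable_le_real d (T : measurableType d) (R : realType)
    (mu : {measure set T -> \bar R}) (f g : T -> R) :
  measurable_fun setT f -> (forall x, `|f x| <= g x) ->
  mu.-integrable setT (EFin \o g) -> mu.-integrable setT (EFin \o f).
Proof.
move=> mf fg; apply: le_integrable => //; first exact/measurable_EFinP.
by move=> x _; rewrite /= lee_fin (le_trans (fg x))// ler_norm.
Qed.

(** * Elimination of one coordinate and induction on the dimension *)

Section gaussian_slices.
Context {R : realType} {n : nat}.
Implicit Types (B : 'M[R[i]]_(1 + n)) (w v : 'cV[R[i]]_(1 + n)) (y : 'cV[R]_n).

Lemma gaussian_col_mx B w (x : R) y : B^T = B ->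
  gaussian B w (col_mx x%:M y) =
  cexp (- (1 / 2) * dotC (toC y) (drsubmx B *m toC y) + dotC (dsubmx w) (toC y)) *
  cexp (- (1 / 2) * (x%:C * B 0 0 * x%:C)
        + (w 0 0 - dotC (dlsubmx B) (toC y)) * x%:C).
Proof.
move=> sB; rewrite /gaussian -cexpD /toC map_col_mx map_scalar_mx.
rewrite quadratic_sym_col// dotC_col; congr cexp; by field.
Qed.

Definition slice_factor B w : R[i] :=
  (Num.sqrt (2 * pi))%:C / csqrt (B 0 0) * cexp (1 / 2 * (w 0 0 ^+ 2 / B 0 0)).

(** The one-dimensional formula has pivot [B 0 0] and a linear coefficient affine in [y]; its square
    over the pivot supplies exactly the correction terms of [schur B] and [schur_rhs B w]. *)
Lemma has_Cintegral_gaussian_slice B w y : symRepos B ->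
  has_Cintegral (@lebesgue_measure R) (fun x : R => gaussian B w (col_mx x%:M y))
    (slice_factor B w * gaussian (schur B) (schur_rhs B w) y).
Proof.
move=> sB; have [tB _] := sB; have b0 := pivot_neq0 sB.
have := has_CintegralZ (cexp (- (1 / 2) * dotC (toC y) (drsubmx B *m toC y)
   + dotC (dsubmx w) (toC y)))
  (has_Cintegral_gaussian_line (w 0 0 - dotC (dlsubmx B) (toC y)) (pivot_gt0 sB)).
rewrite (_ : _ * _ = slice_factor B w * gaussian (schur B) (schur_rhs B w) y).
  by apply: eq_has_Cintegral => x; rewrite gaussian_col_mx.
rewrite /slice_factor /gaussian mulrCA -[RHS]mulrA; congr (_ * _).
rewrite -!cexpD quadratic_schur /schur_rhs dotCDl dotCNl dotCZl; congr cexp.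
by field.
Qed.

End gaussian_slices.

Section gaussian_integral.
Context {R : realType}.

Lemma col_of_cons n (x : R) (t : n.-tuple (measurableTypeR R)) :
  col_of [tuple of x :: t] = col_mx x%:M (col_of t).
Proof.
apply/matrixP => i j; rewrite mxE [RHS]mxE.
case: splitP => [k ik|k ik].
  rewrite (ord1 j) (ord1 k) mxE eqxx mulr1n (tnth_nth x) /=.
  by rewrite ik (ord1 k).
by rewrite mxE !(tnth_nth x) /= ik.
Qed.

Lemma gaussian_toC n (P : 'M[R]_n) (u x : 'cV[R]_n) :
  gaussian (toC P) (toC u) x =
  (expR (- (1 / 2) * (x^T *m P *m x) 0 0 + (u^T *m x) 0 0))%:C.
Proof.
rewrite -cexp_real /gaussian; congr cexp; rewrite /dotC mulmxA.
have E m k l (M : 'M[R]_(m, k)) (M' : 'M[R]_(k, l)) : toC M *m toC M' = toC (M *m M').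
  by rewrite /toC map_mxM.
have Et m k (M : 'M[R]_(m, k)) : (toC M)^T = toC M^T.
  by apply/matrixP => i j; rewrite !mxE.
by rewrite !Et !E rmorphD rmorphM !mxE rmorphN fmorph_div rmorph1 !rmorph_nat.
Qed.

(** Since [|exp z| = exp (Re z)], the majorant is again a Gaussian, to which the slice formula
    applies. *)
Lemma norm_Re_Im_gaussian n (B : 'M[R[i]]_n) w x :
  `|complex.Re (gaussian B w x)| <=
    complex.Re (gaussian (toC (Remx B)) (toC (Remx w)) x) /\
  `|complex.Im (gaussian B w x)| <=
    complex.Re (gaussian (toC (Remx B)) (toC (Remx w)) x).
Proof.
rewrite gaussian_toC /gaussian Re_cexp Im_cexp !normrM ger0_norm ?expR_ge0//.
have -> : complex.Re (- (1 / 2) * dotC (toC x) (B *m toC x) + dotC w (toC x)) =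
    - (1 / 2) * (x^T *m Remx B *m x) 0 0 + ((Remx w)^T *m x) 0 0.
  rewrite -Re_quadratic -Re_dotC.
  have -> : (1 / 2 : R[i]) = (1 / 2 : R)%:C by rewrite rmorphM/= fmorphV /= !rmorph_nat.
  by case: (dotC _ _) (dotC _ _) => [? ?] [? ?]; simpc.
split; rewrite [leRHS]/= ler_piMr ?expR_ge0//.
  by rewrite ler_norml cos_geN1 cos_le1.
by rewrite ler_norml sin_geN1 sin_le1.
Qed.

Lemma has_Rintegral_lebesgue0 (f : 0.-tuple (measurableTypeR R) -> R) :
  has_Rintegral (lebesgue_measure_Rd R 0) f (f [tuple]).
Proof.
have mf (g : 0.-tuple (measurableTypeR R) -> R) : measurable_fun setT (EFin \o g).
  rewrite (_ : EFin \o g = cst (g [tuple])%:E); first exact: measurable_cst.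
  by apply/funext => t /=; rewrite (tuple0 t).
have fE g : (\int[lebesgue_measure_Rd R 0]_x (g x)%:E = (g [tuple])%:E)%E.
  by rewrite [LHS](integral_dirac [tuple] measurableT (mf g)) diracT mul1e.
split; last by rewrite /Rintegral fE.
by apply/integrableP; split => //; rewrite (fE (fun x => `|f x|)) ltry.
Qed.

(** A solution [v] of [B v = w] stands for [B^-1 w]: under elimination it just loses its first
    entry, whereas the inverse of [B] would need a block formula. *)
Theorem has_Cintegral_gaussian n (B : 'M[R[i]]_n) (w v : 'cV[R[i]]_n) :
  symRepos B -> B *m v = w ->
  has_Cintegral (lebesgue_measure_Rd R n) (fun t => gaussian B w (col_of t))
    ((Num.sqrt (2 * pi) ^+ n)%:C / sdet B * cexp (1 / 2 * dotC w v)).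
Proof.
elim: n B w v => [|n ih] B w v sB Bv.
  have d0 (u u' : 'cV[R[i]]_0) : dotC u u' = 0 by rewrite /dotC mxE big_ord0.
  have g0 t : gaussian B w (@col_of R 0 t) = 1.
    by rewrite /gaussian !d0 mulr0 addr0 cexp0.
  rewrite d0 mulr0 cexp0 mulr1 expr0 divr1.
  split; [rewrite -[X in has_Rintegral _ _ X]/(complex.Re 1) -(g0 [tuple])
         |rewrite -[X in has_Rintegral _ _ X]/(complex.Im 1) -(g0 [tuple])].
    exact: (has_Rintegral_lebesgue0 (fun t => complex.Re (gaussian B w (col_of t)))).
  exact: (has_Rintegral_lebesgue0 (fun t => complex.Im (gaussian B w (col_of t)))).
pose m1 := @lebesgue_measure R; pose mn := lebesgue_measure_Rd R n.
(* The matrix is kept general because the induction hypothesis serves twice: for the real majorant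
   [(Re B, Re w)] and for [(B, w)] itself. *)
have ih' (B' : 'M[R[i]]_(1 + n)) (w' : 'cV[R[i]]_(1 + n)) : symRepos B' ->
  has_Cintegral mn
    (fun t => slice_factor B' w' * gaussian (schur B') (schur_rhs B' w') (col_of t))
    (slice_factor B' w' * ((Num.sqrt (2 * pi) ^+ n)%:C / sdet (schur B') *
      cexp (1 / 2 * dotC (schur_rhs B' w') (invmx (schur B') *m schur_rhs B' w')))).
  move=> sB'; apply: has_CintegralZ; apply: ih; first exact: symRepos_schur.
  by rewrite mulKVmx// symRepos_unitmx//; exact: symRepos_schur.
pose T := measurableTypeR R.
have mcons : measurable_fun setT (fun u : T * n.-tuple T => [tuple of u.1 :: u.2]).
  exact: (measurable_cons (f := fst) (g := snd) measurable_fst measurable_snd).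
have slice (B' : 'M[R[i]]_(1 + n)) w' (t : n.-tuple T) : symRepos B' ->
    has_Cintegral m1 (fun x : T => gaussian B' w' (col_of [tuple of x :: t]))
     (slice_factor B' w' * gaussian (schur B') (schur_rhs B' w') (col_of t)).
  move=> sB'; apply: eq_has_Cintegral (has_Cintegral_gaussian_slice _ _ sB') => x.
  by rewrite col_of_cons.
have mg (B' : 'M[R[i]]_(1 + n)) w' := Cmeasurable_gaussian B' w'.
pose gR := gaussian (toC (Remx B)) (toC (Remx w)).
have iR : (m1 \x mn)%E.-integrable setT
    (EFin \o (fun z : T * n.-tuple T =>
      complex.Re (gR (col_of [tuple of z.1 :: z.2])))).
  have sR : symRepos (toC (Remx B)) by apply/symRepos_toC; case: sB.
  apply: integrable_prod_ge0 (proj1 (proj1 (ih' _ (toC (Remx w)) sR))).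
  - exact: measurableT_comp (mg _ _).1 mcons.
  - by move=> z; rewrite /gR gaussian_toC expR_ge0.
  - by move=> t; exact: (slice _ _ t sR).1.
have iRe : (m1 \x mn)%E.-integrable setT
    (EFin \o (fun z : T * n.-tuple T =>
      complex.Re (gaussian B w (col_of [tuple of z.1 :: z.2])))).
  apply: (integrable_le_real _ _ iR) => [|z].
    exact: (measurableT_comp (mg _ _).1 mcons).
  exact: (norm_Re_Im_gaussian _ _ _).1.
have iIm : (m1 \x mn)%E.-integrable setT
    (EFin \o (fun z : T * n.-tuple T =>
      complex.Im (gaussian B w (col_of [tuple of z.1 :: z.2])))).
  apply: (integrable_le_real _ _ iR) => [|z].
    exact: (measurableT_comp (mg _ _).2 mcons).
  exact: (norm_Re_Im_gaussian _ _ _).2.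
have [tB _] := sB; have b0 := pivot_neq0 sB.
have [sv wv] := schur_solution tB b0 Bv.
have vE : invmx (schur B) *m schur_rhs B w = dsubmx (v : 'cV[R[i]]_(1 + n)).
  by rewrite -sv mulKmx// symRepos_unitmx//; exact: symRepos_schur.
have := ih' _ w sB; rewrite vE.
rewrite (_ : slice_factor B w * ((Num.sqrt (2 * pi) ^+ n)%:C / sdet (schur B)
    * cexp (1 / 2 * dotC (schur_rhs B w) (dsubmx (v : 'cV[R[i]]_(1 + n))))) =
    (Num.sqrt (2 * pi) ^+ n.+1)%:C / sdet B * cexp (1 / 2 * dotC w v)).
  move=> [h1 h2]; split; apply: has_Rintegral_product_cons.
  - exact: (mg _ _).1.
  - by apply: (has_Rintegral_prod iRe _ h1) => t; exact: (slice _ _ t sB).1.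
  - exact: (mg _ _).2.
  - by apply: (has_Rintegral_prod iIm _ h2) => t; exact: (slice _ _ t sB).2.
rewrite wv (mulrDr (1 / 2)) cexpD /slice_factor [_ ^+ n.+1]exprS.
rewrite [(_ * _ ^+ n)%:C]rmorphM /=; field.
by rewrite sdet_neq0 csqrt_neq0.
Qed.

End gaussian_integral.

(** * The branch of the square root of the determinant *)

Section componentwise_limits.
Context {R : realType} {T : Type} {F : set_system T} {FF : Filter F}.
Implicit Types (f g : T -> R[i]) (z w : R[i]).

Definition Ccvg f z :=
  (complex.Re (f t) @[t --> F] --> complex.Re z) /\
  (complex.Im (f t) @[t --> F] --> complex.Im z).

(** The norm of [R[i]] has values in [R[i]], where a positive radius is real by definition of the
    order; balls are then compared with squares in the real and imaginary parts. *)
Lemma CcvgP f z : f @ F --> z <-> Ccvg f z.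
Proof.
split=> [/cvgrPdist_lt fz|[/cvgrPdist_lt fr /cvgrPdist_lt fi]].
  split; apply/cvgrPdist_lt => e e0.
    have eC : 0 < e%:C :> R[i] by rewrite ltcR.
    apply: filterS (fz _ eC) => t; rewrite -ltcR; apply: le_lt_trans.
    have := normc_ge_Re (z - f t); by case: z {fz} (f t) => [? ?] [? ?].
  have eC : 0 < e%:C :> R[i] by rewrite ltcR.
  apply: filterS (fz _ eC) => t; rewrite normc_def ltcR; apply: le_lt_trans.
  rewrite -sqrtr_sqr ler_wsqrtr//.
  by case: z {fz} (f t) => [? ?] [? ?] /=; rewrite lerDr sqr_ge0.
apply/cvgrPdist_lt => e e0.
have [d0 eE] : 0 < complex.Re e /\ e = (complex.Re e)%:C.
  by move: e0; case: e => a b; rewrite ltcE /= => /andP[/eqP -> ->].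
have d20 : 0 < complex.Re e / 2 by rewrite divr_gt0.
have normE (u v : R[i]) : `|complex.Re u - complex.Re v| < complex.Re e / 2 ->
    `|complex.Im u - complex.Im v| < complex.Re e / 2 -> `|u - v| < e.
  move=> hr hi; rewrite eE normc_def ltcR -[ltRHS]ger0_norm ?ltW// -sqrtr_sqr.
  rewrite ltr_sqrt ?exprn_gt0//.
  move: hr hi; case: u v => [a b] [a' b'] /=.
  by rewrite !ltr_norml => /andP[h1 h2] /andP[h3 h4]; nra.
near=> t; apply: normE; near: t; [exact: fr|exact: fi].
Unshelve. all: end_near. Qed.

Lemma Ccvg_cst z : Ccvg (fun=> z) z.
Proof. by split; exact: cvg_cst. Qed.

Lemma CcvgB f g z w : Ccvg f z -> Ccvg g w -> Ccvg (fun t => f t - g t) (z - w).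
Proof.
have E1 (u v : R[i]) : complex.Re (u - v) = complex.Re u - complex.Re v.
  by case: u v => [? ?] [? ?].
have E2 (u v : R[i]) : complex.Im (u - v) = complex.Im u - complex.Im v.
  by case: u v => [? ?] [? ?].
by move=> [f1 f2] [g1 g2]; split; rewrite ?E1 ?E2;
  [under eq_fun do rewrite E1|under eq_fun do rewrite E2]; exact: cvgB.
Qed.

Lemma CcvgM f g z w : Ccvg f z -> Ccvg g w -> Ccvg (fun t => f t * g t) (z * w).
Proof.
have E1 (u v : R[i]) : complex.Re (u * v) =
    complex.Re u * complex.Re v - complex.Im u * complex.Im v.
  by case: u v => [? ?] [? ?].
have E2 (u v : R[i]) : complex.Im (u * v) =
    complex.Re u * complex.Im v + complex.Im u * complex.Re v.
  by case: u v => [? ?] [? ?].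
move=> [f1 f2] [g1 g2]; split.
  by rewrite E1; under eq_fun do rewrite E1; apply: cvgB; exact: cvgM.
by rewrite E2; under eq_fun do rewrite E2; apply: cvgD; exact: cvgM.
Qed.

Lemma CcvgV f z : z != 0 -> Ccvg f z -> Ccvg (fun t => (f t)^-1) z^-1.
Proof.
have E1 (u : R[i]) : complex.Re u^-1 =
    complex.Re u / (complex.Re u ^+ 2 + complex.Im u ^+ 2) by case: u.
have E2 (u : R[i]) : complex.Im u^-1 =
    - complex.Im u / (complex.Re u ^+ 2 + complex.Im u ^+ 2).
  by case: u => ? ?; rewrite mulNr.
move=> z0 [f1 f2].
have n0 : complex.Re z ^+ 2 + complex.Im z ^+ 2 != 0.
  apply: contraNneq z0 => /eqP; rewrite paddr_eq0 ?sqr_ge0// !sqrf_eq0.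
  by case: z {f1 f2} => a b /=; rewrite eq_complex.
have nV : (complex.Re (f t) ^+ 2 + complex.Im (f t) ^+ 2)^-1 @[t --> F] -->
    (complex.Re z ^+ 2 + complex.Im z ^+ 2)^-1.
  by apply: cvgV => //; apply: cvgD; rewrite !expr2; exact: cvgM.
split; first by rewrite E1; under eq_fun do rewrite E1; exact: cvgM.
rewrite E2; under eq_fun do rewrite E2; apply: cvgM => //.
exact: cvgN.
Qed.

Lemma Ccvg_cexp f z : Ccvg f z -> Ccvg (fun t => cexp (f t)) (cexp z).
Proof.
move=> [f1 f2]; split.
  rewrite Re_cexp; under eq_fun do rewrite Re_cexp.
  apply: cvgM; first by apply: continuous_cvg f1; exact: continuous_expR.
  by apply: continuous_cvg f2; exact: continuous_cos.
rewrite Im_cexp; under eq_fun do rewrite Im_cexp.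
apply: cvgM; first by apply: continuous_cvg f1; exact: continuous_expR.
by apply: continuous_cvg f2; exact: continuous_sin.
Qed.

Lemma Ccvg_csqrt f z : 0 < complex.Re z -> Ccvg f z ->
  Ccvg (fun t => csqrt (f t)) (csqrt z).
Proof.
move=> z0 [f1 f2]; apply: Ccvg_cexp; split => /=.
  apply: cvgM; last exact: cvg_cst.
  apply: (@continuous_cvg _ _ _ _ _ _ (@ln R)).
    by apply: continuous_ln; rewrite ltr_wpDr ?exprn_gt0// sqr_ge0.
  by apply: cvgD; rewrite !expr2; exact: cvgM.
apply: cvgM; last exact: cvg_cst.
apply: (@continuous_cvg _ _ _ _ _ _ (@atan R)); first exact: continuous_atan.
by apply: cvgM => //; apply: cvgV => //; rewrite gt_eqF.
Qed.

Lemma cvg_mx_entriesP m n (M : T -> 'M[R[i]]_(m, n)) (B : 'M[R[i]]_(m, n)) :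
  M @ F --> B <-> forall i j, Ccvg (fun t => M t i j) (B i j).
Proof.
split=> [MB i j|MB].
  apply/CcvgP => A nA; apply: (MB (fun N => A (N i j))).
  (* A basic neighbourhood of a matrix is a matrix of neighbourhoods; this one constrains only the
     entry [(i, j)]. *)
  exists (fun i' j' => if (i' == i) && (j' == j) then A else setT).
    move=> i' j'; case: ifP => [/andP[/eqP -> /eqP ->]//|_]; exact: filterT.
  by move=> N /(_ i j); rewrite !eqxx.
move=> A [P nP PA]; rewrite nbhs_simpl /=.
apply: (@filterS _ _ _ (fun t => forall i j, P i j (M t i j))).
  by move=> t Pt; exact: PA.
apply: filter_forall => i; apply: filter_forall => j.
by have /CcvgP := MB i j; exact.
Qed.

End componentwise_limits.

Section branch.
Context {R : realType}.

Lemma Ccvg_schur n T (F : set_system T) {FF : Filter F}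
    (M : T -> 'M[R[i]]_(1 + n)) (B : 'M[R[i]]_(1 + n)) : B 0 0 != 0 ->
  (forall i j, Ccvg (F := F) (fun t => M t i j) (B i j)) ->
  forall i j, Ccvg (F := F) (fun t => schur (M t) i j) (schur B i j).
Proof.
move=> b0 MB i j.
have E (N : 'M[R[i]]_(1 + n)) : schur N i j =
    N (rshift 1 i) (rshift 1 j) - (N 0 0)^-1 *
    (N (rshift 1 i) (lshift n 0) * N (rshift 1 j) (lshift n 0)).
  by rewrite !mxE big_ord1 !mxE.
rewrite (_ : (fun t => _) = (fun t => M t (rshift 1 i) (rshift 1 j) -
    (M t 0 0)^-1 * (M t (rshift 1 i) (lshift n 0) * M t (rshift 1 j) (lshift n 0)))).
  2: by apply/funext => t; exact: E.
rewrite E; apply: CcvgB => //; apply: CcvgM; first exact: CcvgV.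
exact: CcvgM.
Qed.

Lemma Ccvg_sdet n T (F : set_system T) {FF : Filter F}
    (M : T -> 'M[R[i]]_n) (B : 'M[R[i]]_n) : symRepos B ->
  (forall i j, Ccvg (F := F) (fun t => M t i j) (B i j)) ->
  Ccvg (F := F) (fun t => sdet (M t)) (sdet B).
Proof.
elim: n M B => [|n ih] M B sB MB /=; first exact: Ccvg_cst.
apply: CcvgM; first by apply: Ccvg_csqrt; [exact: pivot_gt0|exact: MB].
apply: ih; first exact: symRepos_schur.
by apply: Ccvg_schur => //; exact: pivot_neq0.
Qed.

Lemma sqrt_det_branch_sdet n : sqrt_det_branch (@sdet R n).
Proof.
split; [|exact: sqr_sdet|exact: sdet_real_gt0].
apply/subspace_continuousP => B sB.
apply/CcvgP; apply: Ccvg_sdet => //.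
apply/(cvg_mx_entriesP id); exact: cvg_within.
Qed.

Variables (n : nat) (s1 s2 : 'M[R[i]]_n -> R[i]).
Hypotheses (b1 : sqrt_det_branch s1) (b2 : sqrt_det_branch s2).

(** Membership in [symRepos] bears only on symmetry and the real part, so scaling the imaginary part
    never leaves it. The path joins [Re B], where any branch is positive, to [B]. *)
Let path (B : 'M[R[i]]_n) (t : R) : 'M[R[i]]_n :=
  toC (Remx B) + ('i%C * t%:C) *: toC (Immx B).

Let pathE B t i j : path B t i j = complex.Re (B i j) +i* (t * complex.Im (B i j)).
Proof. by rewrite !mxE; simpc. Qed.

Let Remx_path B t : Remx (path B t) = Remx B.
Proof. by apply/matrixP => i j; rewrite mxE pathE mxE. Qed.

Let symRepos_path B t : symRepos B -> symRepos (path B t).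
Proof.
move=> [sB pB]; split; last by rewrite Remx_path.
by apply/matrixP => i j; rewrite mxE !pathE -{1 2}sB !mxE.
Qed.

Let path0 B : path B 0 = toC (Remx B).
Proof. by rewrite /path mulr0 scale0r addr0. Qed.

Let path1 B : path B 1 = B.
Proof. by apply/matrixP => i j; rewrite pathE mul1r; case: (B i j). Qed.

Let Ccvg_branch s B t : sqrt_det_branch s -> symRepos B ->
  Ccvg (F := nbhs t) (fun u => s (path B u)) (s (path B t)).
Proof.
move=> [/subspace_continuousP cs _ _] sB; apply/CcvgP.
apply: cvg_trans (cs _ (symRepos_path t sB)) => A /= nA.
have : path B u @[u --> t] --> path B t.
  apply/(cvg_mx_entriesP (path B)) => i j; split; rewrite [path B t i j]pathE /=.
    by under eq_fun do rewrite pathE /=; exact: cvg_cst.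
  under eq_fun do rewrite pathE /=.
  by apply: cvgM; [exact: cvg_id|exact: cvg_cst].
move/(_ _ nA); rewrite !nbhs_simpl /=; apply: filterS => u; apply.
exact: symRepos_path.
Qed.

(* The ratio s1 / s2 takes the values 1 and -1 and is continuous along
   Re B + i t Im B, 0 <= t <= 1, hence keeps its value 1 at t = 0. *)
Lemma sqrt_det_branch_unique B : symRepos B -> s1 B = s2 B.
Proof.
move=> sB; have [_ q1 r1] := b1; have [_ q2 r2] := b2.
have s20 t : s2 (path B t) != 0.
  have := symRepos_unitmx (symRepos_path t sB); rewrite unitmxE unitfE.
  by rewrite -q2 ?expf_eq0//; exact: symRepos_path.
pose h t := s1 (path B t) / s2 (path B t).
have h2 t : (h t == 1) || (h t == -1).
  rewrite -sqrf_eq1 /h expr_div_n q1 ?q2; try exact: symRepos_path.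
  by rewrite divff// -q2 ?expf_neq0//; exact: symRepos_path.
have ch : continuous (fun t => complex.Re (h t)).
  move=> t; suff [] : Ccvg (F := nbhs t) h (h t) by [].
  by apply: CcvgM; [exact: Ccvg_branch|apply: CcvgV => //; exact: Ccvg_branch].
have h0 : h 0 = 1.
  have p1 := r1 _ sB.2; have p2 := r2 _ sB.2.
  case/orP: (h2 0) => /eqP; [exact|rewrite /h path0 => e; move: p1].
  rewrite -[s1 _](divfK (lt0r_neq0 p2)) e mulN1r.
  by rewrite oppr_gt0 => /lt_trans/(_ p2); rewrite ltxx.
have h1 : h 1 = 1.
  case/orP: (h2 1) => /eqP e; first exact: e.
  (* If [h 1] were [-1], the real part of [h] would vanish somewhere on [[0, 1]], although [h] takes
     only the values 1 and -1. *)
  have /(IVT ler01) : {within `[0, 1], continuous (fun t => complex.Re (h t))}.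
    exact: continuous_subspaceT.
  move=> /(_ 0); rewrite h0 e /= => -[|c _ hc].
    by rewrite ge_min le_max; apply/andP; split; apply/orP; [right|left]; lra.
  by case/orP: (h2 c) hc => /eqP -> /= /eqP; rewrite ?oppr_eq0 oner_eq0.
by move: h1; rewrite /h path1 => /divr1_eq.
Qed.

End branch.

Lemma sqrt_detE (R : realType) n (B : 'M[R[i]]_n) : symRepos B -> sqrt_det B = sdet B.
Proof.
move=> sB; apply: sqrt_det_branch_unique => //; last exact: sqrt_det_branch_sdet.
by apply: xgetPex; exists (@sdet R n); exact: sqrt_det_branch_sdet.
Qed.

(** * Gaussian wave packets *)

Section semiclassical_gaussian.
Context {R : realType} {n : nat}.
Implicit Types (B : 'M[R[i]]_n) (b w v : 'cV[R[i]]_n) (q : 'cV[R]_n).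

Lemma toCB m k (M N : 'M[R]_(m, k)) : toC (M - N) = toC M - toC N.
Proof. by apply/matrixP => i j; rewrite !mxE rmorphB. Qed.

Lemma dotC_symmetric B v w : B^T = B -> dotC v (B *m w) = dotC w (B *m v).
Proof. by move=> sB; rewrite dotC_mulmx sB dotCC. Qed.

(** Expanding the quadratic form turns the shifted Gaussian into a constant times the Gaussian with
    linear term [w + B q]; in the closed form the constant cancels against the change of
    exponent. *)
Lemma has_Cintegral_gaussian_shift B w v q : symRepos B -> B *m v = w ->
  has_Cintegral (lebesgue_measure_Rd R n) (fun t => gaussian B w (col_of t - q))
    ((Num.sqrt (2 * pi) ^+ n)%:C / sdet B * cexp (1 / 2 * dotC w v)).
Proof.
move=> sB Bv; have [tB _] := sB.
have Bvq : B *m (v + toC q) = w + B *m toC q by rewrite mulmxDr Bv.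
have := has_CintegralZ
  (cexp (- (1 / 2) * dotC (toC q) (B *m toC q) - dotC w (toC q)))
  (has_Cintegral_gaussian sB Bvq).
rewrite mulrCA -cexpD.
have -> : - (1 / 2) * dotC (toC q) (B *m toC q) - dotC w (toC q) +
    1 / 2 * dotC (w + B *m toC q) (v + toC q) = 1 / 2 * dotC w v.
  rewrite dotCDl !dotCDr (dotCC (B *m toC q)) (dotC_symmetric _ _ tB) Bv.
  by rewrite (dotCC (B *m toC q)) (dotCC (toC q) w); field.
apply: eq_has_Cintegral => t; rewrite /gaussian -cexpD toCB.
rewrite mulmxBr !(dotCDl, dotCDr, dotCNl, dotCNr) (dotCC (B *m _)).
rewrite (dotC_symmetric (toC (col_of t)) (toC q) tB); congr cexp.
move: (dotC _ _) (dotC _ _) (dotC _ _) (dotC _ _) (dotC _ _) => *; by field.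
Qed.

Variable eps : R.
Hypothesis eps0 : 0 < eps.

(** This is the previous formula for [B / eps] and [w = i b / eps], solved by [v = i B^-1 b]. The
    scaling of [sdet] moves [eps] under the root of [2 pi], and [i^2] gives the minus sign. *)
Lemma has_Cintegral_semiclassical B b q : symRepos B ->
  has_Cintegral (lebesgue_measure_Rd R n)
    (fun t => let y := toC (col_of t - q) in
      cexp (- (1 / (2 * eps%:C)) * dotC y (B *m y) + 'i%C / eps%:C * dotC b y))
    ((Num.sqrt (2 * pi * eps) ^+ n)%:C / sdet B *
     cexp (- (1 / (2 * eps%:C)) * dotC b (invmx B *m b))).
Proof.
move=> sB; have uB := symRepos_unitmx sB.
have eC : eps%:C != 0 :> R[i] by rewrite fmorph_eq0 gt_eqF.
have sBe : symRepos ((eps^-1)%:C *: B).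
  case: sB => tB [tP pP]; split; first by rewrite linearZ /= tB.
  have E : Remx ((eps^-1)%:C *: B) = eps^-1 *: Remx B.
    by apply/matrixP => i j; rewrite !mxE; case: (B i j) => ? ?; simpc.
  split; first by rewrite E linearZ /= tP.
  by move=> x x0; rewrite E -scalemxAr -scalemxAl mxE mulr_gt0 ?invr_gt0 ?pP.
have Bv : ((eps^-1)%:C *: B) *m ('i%C *: (invmx B *m b)) = ('i%C / eps%:C) *: b.
  by rewrite -scalemxAr -scalemxAl mulKVmx// scalerA fmorphV.
have := has_Cintegral_gaussian_shift q sBe Bv.
rewrite sdetZ ?invr_gt0// dotCZl dotCZr.
have -> : (Num.sqrt (2 * pi) ^+ n)%:C / ((Num.sqrt eps^-1 ^+ n)%:C * sdet B) =
    (Num.sqrt (2 * pi * eps) ^+ n)%:C / sdet B.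
  rewrite invfM mulrA; congr (_ / _).
  rewrite -fmorphV -rmorphM sqrtrV ?ltW// exprVn invrK -exprMn -sqrtrM//.
  by rewrite mulr_ge0// pi_ge0.
have -> : 1 / 2 * ('i%C / eps%:C * ('i%C * dotC b (invmx B *m b))) =
    - (1 / (2 * eps%:C)) * dotC b (invmx B *m b).
  transitivity ('i%C ^+ 2 / (2 * eps%:C) * dotC b (invmx B *m b)); first by field.
  by rewrite sqr_i; field.
apply: eq_has_Cintegral => t; rewrite /gaussian -scalemxAl dotCZr dotCZl fmorphV.
by congr cexp; field.
Qed.

End semiclassical_gaussian.

Section Cintegral_bridge.
Context {R : realType} {n : nat}.

Lemma has_Cintegral_Cintegrable (f : 'cV[R]_n -> R[i]) u :
  has_Cintegral (lebesgue_measure_Rd R n) (fun t => f (col_of t)) u ->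
  Cintegrable f /\ Cintegral f = u.
Proof.
move=> [[r1 r2] [i1 i2]]; split; first by split.
by rewrite /Cintegral; apply: eq_complexP.
Qed.

End Cintegral_bridge.

(** * The inner product, the integrand in [p] and the constants *)

Section wave_packets.
Context {R : realType} {d : nat}.
Variables (eps : R) (C C0 : 'M[R[i]]_d) (q0 p0 : 'cV[R]_d).
Hypotheses (eps0 : 0 < eps) (sC : siegel C) (sC0 : siegel C0).

Local Notation A := (Amx C C0).
Local Notation Ainv := (- 'i%C *: (C0 - Defs.conjmx C)).

Lemma symRepos_Ainv : symRepos Ainv.
Proof.
have [tC [tP pP]] := sC; have [tC0 [tP0 pP0]] := sC0.
have tA : Ainv^T = Ainv.
  by rewrite linearZ linearB /= /Defs.conjmx map_trmx tC tC0.
have E : Remx Ainv = Immx C0 + Immx C.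
  apply/matrixP => i j; rewrite !mxE.
  by case: (C0 i j) (C i j) => [? ?] [? ?]; simpc => /=; ring.
split=> //; split; first by rewrite /Remx map_trmx tA.
by move=> x x0; rewrite E mulmxDr mulmxDl mxE addr_gt0 ?pP ?pP0.
Qed.

Lemma invmx_Ainv : invmx Ainv = A.
Proof.
have := symRepos_unitmx symRepos_Ainv => uA.
rewrite /Amx invmxZ//; congr (_ *: _).
by apply: (mulfI (_ : - 'i%C != 0 :> R[i])); rewrite ?oppr_eq0 ?neq0Ci//
  mulfV ?oppr_eq0 ?neq0Ci// mulNr -expr2 sqr_i opprK.
Qed.

Lemma invmx_Amx : invmx A = Ainv.
Proof. by rewrite -invmx_Ainv invmxK. Qed.

Lemma symRepos_Amx : symRepos A.
Proof. by rewrite -invmx_Ainv; exact/symRepos_invmx/symRepos_Ainv. Qed.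

Local Notation peak D := ((pi * eps) `^ (- (d%:R / 4)) * (\det (Immx D)) `^ (1 / 4))%:C.
Local Notation Iod := ('i%C / eps%:C).
Local Notation moH := (- (1 / (2 * eps%:C))).

Lemma conjc_cexp (z : R[i]) : conjc (cexp z) = cexp (conjc z).
Proof.
case: z => x y; apply: eq_complexP.
  by rewrite Re_cexp /= cosN /cexp /=; simpc.
by rewrite Im_cexp /= sinN /cexp /=; simpc => /=; ring.
Qed.

Lemma conjcM (z w : R[i]) : conjc (z * w) = conjc z * conjc w.
Proof. exact: rmorphM. Qed.

Lemma conjcD (z w : R[i]) : conjc (z + w) = conjc z + conjc w.
Proof. exact: rmorphD. Qed.

Lemma conjcV (z : R[i]) : conjc z^-1 = (conjc z)^-1.
Proof. exact: fmorphV. Qed.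

Lemma conjc_dotC (u v : 'cV[R[i]]_d) :
  conjc (dotC u v) = dotC (Defs.conjmx u) (Defs.conjmx v).
Proof.
rewrite /dotC !mxE rmorph_sum; apply: eq_bigr => i _.
by rewrite !mxE rmorphM.
Qed.

Lemma conjmx_toC m k (M : 'M[R]_(m, k)) : Defs.conjmx (toC M) = toC M.
Proof. by apply/matrixP => i j; rewrite !mxE /= oppr0. Qed.

(** Both packets are expanded around [q]. The forms of [C0] and of the conjugate of [C] then merge
    into [A^-1], and the constant exponential is that of [psi_0] at [q]. *)
Lemma inner_integrandE q p (x : 'cV[R]_d) :
  inner_integrand (wave_packet C eps (q, p)) (wave_packet C0 eps (q0, p0)) x =
  peak C * peak C0 * cexp (Iod * (1 / 2 * dotC (toC (q - q0)) (C0 *m toC (q - q0))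
      + dotC (toC p0) (toC (q - q0)))) *
  (let y := toC (x - q) in
   cexp (moH * dotC y (Ainv *m y)
         + Iod * dotC (C0 *m toC (q - q0) + toC p0 - toC p) y)).
Proof.
have tC0 : C0^T = C0 by case: sC0.
have eC : eps%:C != 0 :> R[i] by rewrite fmorph_eq0 gt_eqF.
rewrite /inner_integrand /wave_packet conjcM conjc_cexp.
rewrite [conjc (_)%:C](_ : _ = peak C); last by rewrite /= oppr0.
cbv zeta; rewrite mulrACA -cexpD -[RHS]mulrA -cexpD; congr (_ * cexp _).
have -> : x - q0 = (x - q) + (q - q0) by rewrite addrA subrK.
set y := x - q; set u := q - q0.
have -> : toC (y + u) = toC y + toC u by apply/matrixP => i j; rewrite !mxE rmorphD.
have cI (z : R[i]) : conjc (Iod * z) = - Iod * conjc z.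
  rewrite conjcM; congr (_ * _); rewrite conjcM -mulNr; congr (_ * _).
    by apply: eq_complexP => /=; rewrite ?oppr0.
  by rewrite conjcV; congr (_^-1); rewrite /= oppr0.
have ch : conjc (1 / 2 : R[i]) = 1 / 2.
  rewrite conjcM conjcV; congr (_ / _); apply: eq_complexP => /=;
    by rewrite ?addr0 ?oppr0.
have cM (v : 'cV[R[i]]_d) : Defs.conjmx (C *m v) = Defs.conjmx C *m Defs.conjmx v.
  exact: map_mxM.
rewrite cI conjcD conjcM !conjc_dotC cM !conjmx_toC ch.
rewrite -scalemxAl mulmxBl mulmxDr !(dotCDl, dotCDr, dotCNl, dotCNr, dotCZr).
rewrite (dotC_symmetric (toC u) (toC y) tC0) (dotCC (C0 *m toC u)).
move: (dotC _ _) (dotC _ _) (dotC _ _) (dotC _ _) (dotC _ _) (dotC _ _) (dotC _ _) => *.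
by field.
Qed.

Lemma has_Cintegral_inner q p :
  has_Cintegral (lebesgue_measure_Rd R d) (fun t => inner_integrand
     (wave_packet C eps (q, p)) (wave_packet C0 eps (q0, p0)) (col_of t))
  (peak C * peak C0 * cexp (Iod * (1 / 2 * dotC (toC (q - q0)) (C0 *m toC (q - q0))
      + dotC (toC p0) (toC (q - q0)))) *
   ((Num.sqrt (2 * pi * eps) ^+ d)%:C / sdet Ainv *
     cexp (moH * dotC (C0 *m toC (q - q0) + toC p0 - toC p)
        (A *m (C0 *m toC (q - q0) + toC p0 - toC p))))).
Proof.
rewrite -invmx_Ainv.
apply: eq_has_Cintegral (has_CintegralZ _
  (has_Cintegral_semiclassical eps0 _ q symRepos_Ainv)) => t.
by rewrite inner_integrandE.
Qed.

(** The part independent of [p]: the exponent of [psi_0] at [q], the term of [<g | psi_0>] quadratic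
    in [C0 (q - q0)], and the exponent at [x] of the packet centred at [(q, p0)]. *)
Definition I_factor q x : R[i] :=
  peak C * peak C0 * peak C * ((Num.sqrt (2 * pi * eps) ^+ d)%:C / sdet Ainv) *
  cexp (Iod * (1 / 2 * dotC (toC (q - q0)) (C0 *m toC (q - q0))
          + dotC (toC p0) (toC (q - q0)))
        + moH * dotC (C0 *m toC (q - q0)) (A *m (C0 *m toC (q - q0)))
        + Iod * (1 / 2 * dotC (toC (x - q)) (C *m toC (x - q))
          + dotC (toC p0) (toC (x - q)))).

(* The shift by p0 is what removes p0 from the linear term b_. *)
Lemma I_integrandE q x p : I_integrand eps C C0 q0 p0 q x p =
  I_factor q x * phase_integrand eps C C0 q0 q x (p - p0).
Proof.
have tA : A^T = A by case: symRepos_Amx.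
have eC : eps%:C != 0 :> R[i] by rewrite fmorph_eq0 gt_eqF.
rewrite /I_integrand /inner (has_Cintegral_Cintegrable (has_Cintegral_inner q p)).2.
rewrite /wave_packet /phase_integrand /I_factor /b_.
set e0 := Iod * (_ + dotC (toC p0) (toC (q - q0))).
set K := _ / sdet _.
have -> : C0 *m toC (q - q0) + toC p0 - toC p = C0 *m toC (q - q0) - toC (p - p0).
  by rewrite (toCB p) opprB addrA.
have -> : toC p = toC (p - p0) + toC p0 by rewrite (toCB p) subrK.
rewrite -[A *m C0 *m _]mulmxA.
move: (toC (p - p0)) (C0 *m toC (q - q0)) (toC (x - q)) (toC p0) => P c y r.
transitivity (peak C * peak C0 * peak C * K * (cexp e0 *
   cexp (moH * dotC (c - P) (A *m (c - P))) *
   cexp (Iod * (1 / 2 * dotC y (C *m y) + dotC (P + r) y)))); first by ring.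
rewrite -[RHS]mulrA -!cexpD; congr (_ * cexp _).
(* Needed to match the cross term [c^T A P / eps] of the expanded form with the summand [- i A c] of
   [b_] multiplied by [i / eps]. *)
have iiE z : Iod * ('i%C * z) = - (z / eps%:C).
  transitivity ('i%C ^+ 2 * (z / eps%:C)); first by field.
  by rewrite sqr_i mulN1r.
rewrite mulmxBr !(dotCDl, dotCDr, dotCNl, dotCNr, dotCZl) (dotC_symmetric c P tA).
rewrite (mulrBr Iod (dotC y P)) iiE (dotCC P y) (dotCC (A *m c) P).
move: e0 (dotC y (C *m y)) (dotC y P) (dotC r y) (dotC c _) (dotC P _) (dotC P _) => *.
by field.
Qed.

(** The conjugate of [C] is [C0 - i A^-1]. This reconciles the asymmetric form in the exponent of
    [c_] with the form of [C0 A C0] and the [C0] phase found in [I_factor]. *)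
Lemma conjmx_mulmx_Amx (u : 'cV[R[i]]_d) :
  Defs.conjmx C *m (A *m u) = C0 *m (A *m u) - 'i%C *: u.
Proof.
have E : Defs.conjmx C = C0 - 'i%C *: Ainv.
  by rewrite scalerA mulrN -expr2 sqr_i opprK scale1r opprB addrC subrK.
rewrite {1}E mulmxBl -(scalemxAl 'i%C Ainv) -invmx_Ainv mulKVmx//.
exact/symRepos_unitmx/symRepos_Ainv.
Qed.

Lemma posdefmx_det_gt0 (P : 'M[R]_d) : posdefmx P -> 0 < \det P.
Proof.
move=> pP; have : 0 < sdet (toC P) ^+ 2 by rewrite exprn_gt0// sdet_real_gt0.
rewrite sqr_sdet; last exact/symRepos_toC.
by rewrite /toC det_map_mx ltcR.
Qed.

(** The factors that remain once one packet at [x] is split off: the prefactor of [I_], the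
    normalizations of the two packets in the inner product, and [(2 pi eps)^(d/2)] from its Gaussian
    integral. *)
Lemma wave_packet_normalization :
  ((2 * pi * eps) ^- d * ((pi * eps) `^ (- (d%:R / 4)) * (pi * eps) `^ (- (d%:R / 4)))
   * Num.sqrt (2 * pi * eps) ^+ d) =
  ((pi * eps) ^+ d * Num.sqrt (2 ^+ d))^-1 :> R.
Proof.
have a0 : 0 < pi * eps by rewrite mulr_gt0// pi_gt0.
have -> : (pi * eps) `^ (- (d%:R / 4)) * (pi * eps) `^ (- (d%:R / 4)) =
    (Num.sqrt (pi * eps) ^+ d)^-1.
  rewrite -powRD; last by rewrite (gt_eqF a0) implybT.
  by rewrite /powR gt_eqF// sqrtr_expR// -expRM_natl -expRN; congr expR; field.
have -> : Num.sqrt (2 ^+ d) = Num.sqrt 2 ^+ d :> R.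
  by rewrite -[RHS]ger0_norm ?exprn_ge0// -sqrtr_sqr -exprM mulnC exprM sqr_sqrtr.
have s2 : Num.sqrt 2 != 0 :> R by rewrite gt_eqF// sqrtr_gt0.
have sa : Num.sqrt (pi * eps) != 0 by rewrite gt_eqF// sqrtr_gt0.
rewrite -(mulrA 2 pi eps); move: (pi * eps) a0 sa => a a0 sa.
rewrite sqrtrM// !exprMn.
have sqE (c : R) : 0 <= c -> c ^+ d = (Num.sqrt c ^+ d) ^+ 2.
  by move=> c0; rewrite -exprM mulnC exprM sqr_sqrtr.
rewrite (sqE 2)// (sqE a (ltW a0)).
have := expf_neq0 d s2; have := expf_neq0 d sa.
by move: (Num.sqrt a ^+ d) (Num.sqrt 2 ^+ d) => u v u0 v0; field; rewrite u0 v0.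
Qed.

Lemma I_factorE q x :
  ((2 * pi * eps) ^- d)%:C * I_factor q x =
  wave_packet C eps (0, 0) (x - q) * c_ eps C C0 q0 p0 q x.
Proof.
have eC : eps%:C != 0 :> R[i] by rewrite fmorph_eq0 gt_eqF.
have [tC0 pC0] := sC0; have [tC pC] := sC.
rewrite /I_factor /wave_packet /c_ invmx_Amx (sqrt_detE symRepos_Ainv).
have -> : toC (x - q - 0) = toC (x - q) by rewrite subr0.
have d0 v : dotC (toC (0 : 'cV[R]_d)) v = 0.
  by rewrite /dotC /toC map_mx0 trmx0 mul0mx mxE.
have -> : x - q0 = (q - q0) + (x - q) by rewrite [RHS]addrC addrA subrK.
have -> : toC (q - q0 + (x - q)) = toC (q - q0) + toC (x - q).
  by apply/matrixP => i j; rewrite !mxE rmorphD.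
rewrite -!mulmxA conjmx_mulmx_Amx d0 addr0 !dotCDr dotCNr dotCZr.
rewrite (dotC_symmetric (toC (q - q0)) (A *m _) tC0) (dotCC (A *m _)).
rewrite det_mulmx [(_ * \det (Immx C0)) `^ _]powRM; try exact/ltW/posdefmx_det_gt0.
move: (sdet Ainv) (toC (q - q0)) (toC (x - q)) (toC p0) => S u y r.
have K := wave_packet_normalization.
move: K; set M := _ * Num.sqrt (2 ^+ d).
move: ((pi * eps) `^ _) ((\det _) `^ _) ((\det _) `^ _) ((2 * pi * eps) ^- d).
move=> N D D0 P.
move: (Num.sqrt (2 * pi * eps) ^+ d) M => Q M K.
have -> : moH * (dotC (C0 *m u) (A *m (C0 *m u)) - 'i%C * dotC u (C0 *m u)) +
    Iod * (dotC r u + dotC r y) =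
  moH * dotC (C0 *m u) (A *m (C0 *m u)) + Iod * (1 / 2 * dotC u (C0 *m u)) +
    Iod * (dotC r u + dotC r y).
  by move: (dotC _ _) (dotC u _) (dotC r u) (dotC r y) => *; field.
move: (dotC _ (A *m _)) (dotC u (C0 *m u)) (dotC r u) (dotC r y) (dotC y _).
move=> z1 z2 z3 z4 z5.
have -> : Iod * (1 / 2 * z2 + z3) + moH * z1 + Iod * (1 / 2 * z5 + z4) =
  Iod * (1 / 2 * z5) + (moH * z1 + Iod * (1 / 2 * z2) + Iod * (z3 + z4)) by ring.
rewrite cexpD; move: (cexp _) (cexp _) => e1 e2.
have {}K : P%:C * (N%:C * N%:C) * Q%:C = (M%:C)^-1 by rewrite -!rmorphM K fmorphV.
rewrite ![(_ * _)%:C]rmorphM /= invfM -K; ring.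
Qed.

(** The value does not depend on [s]; the shifts [p0] and 0 are the two that get compared. *)
Lemma has_Cintegral_phase q x s :
  has_Cintegral (lebesgue_measure_Rd R d)
    (fun t => phase_integrand eps C C0 q0 q x (col_of t - s))
    ((Num.sqrt (2 * pi * eps) ^+ d)%:C / sdet A *
     cexp (moH * dotC (b_ C C0 q0 q x) (invmx A *m b_ C C0 q0 q x))).
Proof. exact: (has_Cintegral_semiclassical eps0 _ s symRepos_Amx). Qed.

End wave_packets.

Theorem lemma2p4 (R : realType) (d : nat) (eps : R)
    (C C0 : 'M[R[i]]_d) (q0 p0 : 'cV[R]_d) :
  (1 <= d)%N -> 0 < eps -> siegel C -> siegel C0 ->
  posdefmx (Remx (Amx C C0)) /\
  forall q x : 'cV[R]_d,
  [/\ forall p, Cintegrable (inner_integrand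
        (wave_packet C eps (q, p)) (wave_packet C0 eps (q0, p0))),
      Cintegrable (I_integrand eps C C0 q0 p0 q x),
      Cintegrable (phase_integrand eps C C0 q0 q x)
    & I_ eps C C0 q0 p0 q x =
      wave_packet C eps (0, 0) (x - q) * c_ eps C C0 q0 p0 q x *
      Cintegral (phase_integrand eps C C0 q0 q x)].
Proof.
move=> _ eps0 sC sC0; split; first by case: (symRepos_Amx sC sC0).
move=> q x.
(* At shift 0 this is the integral on the right-hand side, and at shift [p0], times [I_factor], it
   is the one inside [I_]; both share one closed form, which never has to be simplified. *)
have hphase s := has_Cintegral_phase q0 eps0 sC sC0 q x s.
have /has_Cintegral_Cintegrable[iphase phaseE] :=
  eq_has_Cintegral (fun t => congr1 (phase_integrand eps C C0 q0 q x) (subr0 (col_of t)))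
    (hphase 0).
have /has_Cintegral_Cintegrable[iI IE] :=
  eq_has_Cintegral (fun t => esym (I_integrandE q0 p0 eps0 sC sC0 q x (col_of t)))
    (has_CintegralZ (I_factor eps C C0 q0 p0 q x) (hphase p0)).
have iinner p := has_Cintegral_Cintegrable (has_Cintegral_inner q0 p0 eps0 sC sC0 q p).
split; [by move=> p; case: (iinner p)|exact: iI|exact: iphase|].
by rewrite /I_ IE phaseE mulrA I_factorE.
Qed.
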